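(* Let $M$ be a nonzero positive weighted point measure on $\mathbb R$ which is $B$-periodic, where $B>0$, and set $K=B^{-1}M([0,B))$. For every real $s\notin\operatorname{supp}M$, the symmetric principal value \[ F_M(s)=\lim_{A\to\infty}\int_{[-A,A]}\frac{dM(x)}{s-x} \] exists, and $F_M$ is $B$-periodic. If $M$ is random (taking values in the nonzero $B$-periodic positive weighted point measures on $\mathbb R$) and $S$ is uniform on a period and independent of $M$, then, conditionally on $M$, \[ \frac{F_M(S)}{\pi K}\sim\mathrm{Cauchy}(0,1). \]
   Context: A positive weighted point measure is a measure $M=\sum_{x\in X}w_x\delta_x$ on $\mathbb R$ with $X=\operatorname{supp}M$ a locally finite subset of $\mathbb R$ and weights $w_x>0$. $B$-periodic means $M(E+B)=M(E)$ for all Borel $E$. $\mathrm{Cauchy}(0,1)$ is the law on $\mathbb R$ with density $[\pi(1+x^2)]^{-1}$. The variable $S$ is almost surely not an atom of $M$. *)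

(* Defs.v *)
From HB Require Import structures.
From mathcomp Require Import all_boot all_order all_algebra.
From mathcomp Require Import all_classical all_reals all_analysis.
From mathcomp Require Import measurable_realfun.

Set Implicit Arguments.
Unset Strict Implicit.
Unset Printing Implicit Defensive.

Import Order.TTheory GRing.Theory Num.Theory.
Import numFieldNormedType.Exports.

Local Open Scope classical_set_scope.
Local Open Scope ring_scope.

Section point_measures.
Context {R : realType}.
Implicit Types (m : {measure set R -> \bar R}) (X : set R) (B s A : R).

Definition msupp m : set R :=
  [set x | forall U, open U -> U x -> (0 < m U)%E].

Definition locally_finite_set X : Prop :=
  forall a b, finite_set (X `&` `[a, b]).

Definition weighted_point_measure m : Prop :=
  locally_finite_set (msupp m) /\
  exists w : R -> R,
    (forall x, msupp m x -> 0 < w x) /\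
    (forall E, measurable E ->
       m E = \esum_(x in msupp m) ((w x)%:E * \d_x E))%E.

Definition nonzero_measure m : Prop :=
  ~ (forall E, measurable E -> m E = 0%E).

Definition periodic_measure B m : Prop :=
  forall E : set R, measurable E -> m [set x + B | x in E] = m E.

Definition periodic_point_measure B m : Prop :=
  [/\ weighted_point_measure m, nonzero_measure m & periodic_measure B m].

(* The mean density K; [fine] is harmless since a locally finite weighted
   point measure is finite on bounded sets. *)
Definition mean_density B m : R := B^-1 * fine (m `[0, B[%classic).

Definition truncated_integral m s A : \bar R :=
  (\int[m]_(x in `[(- A)%R, A]) ((s - x)^-1)%:E)%E.

(* Meaningful when the limit exists and is finite, in particular for s outside
   the support; at an atom s the term x = s contributes 0^-1 = 0. *)
Definition pv_transform m s : R :=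
  fine (lim (truncated_integral m s A @[A --> +oo])).

Definition cauchy_law (E : set R) : \bar R :=
  (\int[lebesgue_measure]_(x in E) ((pi * (1 + x ^+ 2))^-1)%:E)%E.

End point_measures.

Section conditioning.
Context d (Omega : measurableType d) {R : realType} (P : probability Omega R).

(* A kernel from Omega to R is a random measure on R; this is the sigma-algebra
   it generates, that is, the one making all evaluations at Borel sets
   measurable. *)
Definition sigma_random_measure (M : R.-ker Omega ~> R) : set (set Omega) :=
  <<s \bigcup_(E in measurable)
        preimage_set_system setT (fun w => M w E) measurable >>.

Definition sigma_random_variable (S : Omega -> R) : set (set Omega) :=
  preimage_set_system setT S measurable.

Definition independent_sigma (G H : set (set Omega)) : Prop :=
  forall C D, G C -> H D -> P (C `&` D) = (P C * P D)%E.

(* The random variable Z is a version of the conditional probability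
   P(D | G). *)
Definition conditional_probability (G : set (set Omega)) (D : set Omega)
    (Z : Omega -> \bar R) : Prop :=
  [/\ preimage_set_system setT Z measurable `<=` G,
      P.-integrable setT Z &
      forall C, G C -> (\int[P]_(w in C) Z w = P (D `&` C))%E].

(* Conditionally on the sub-sigma-algebra G, the random variable X has the
   deterministic law mu. *)
Definition conditional_law (G : set (set Omega)) (X : Omega -> R)
    (mu : set R -> \bar R) : Prop :=
  measurable_fun setT X /\
  forall E, measurable E ->
    conditional_probability G (X @^-1` E) (fun=> mu E).

End conditioning.

(* Main.v *)
Require Import Defs.
From HB Require Import structures.
From mathcomp Require Import all_boot all_order all_algebra.
From mathcomp Require Import all_classical all_reals all_analysis.
From mathcomp Require Import measurable_realfun.
From mathcomp Require Import complex.
From mathcomp Require Import ring lra zify.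

Set Implicit Arguments.
Unset Strict Implicit.
Unset Printing Implicit Defensive.

Import Order.TTheory GRing.Theory Num.Theory.
Import numFieldNormedType.Exports.

Local Open Scope classical_set_scope.
Local Open Scope ring_scope.

(** A nonzero [B]-periodic point measure [m] is carried by the translates, by
    multiples of [B], of finitely many points [x_1, ..., x_n] of one period;
    let [w_j] be their masses.  Grouping the atoms of a symmetric window by
    class modulo [B] turns the principal value into the partial fraction
    expansion of the cotangent ([cvg_pole_sum]), so that
      [F(s) = (pi / B) * \sum_j w_j * cot (pi * (s - x_j) / B)]
    ([cvg_truncated_integral]).  This is [B]-periodic, and after division by
    [pi * K] it is a convex combination [G] of translated cotangents.

    Between two consecutive atoms [G] decreases from [+oo] to [-oo], so it
    takes the value [y] exactly once there, say at [r_j] in the gap to the right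
    of [x_j] ([gap_root]).  Over one period the set where [G > y] is therefore,
    up to finitely many points, the union of the intervals from [x_j] to [r_j],
    of total length [T = \sum_j (r_j - x_j)].  In the variable
    [u = exp (2 i pi s / B)] the equation [G(s) = y] is polynomial of degree
    [n], with leading coefficient [i - y], and its constant term depends on the
    [x_j] only through the product of the points [exp (2 i pi x_j / B)].  The
    product of the roots then gives
      [exp (2 i pi T / B) = (y + i) / (y - i)]
    ([cos_sum_roots]), and as [0 < T < B] this forces [T / B] to be
    [(pi / 2 - atan y) / pi], the mass that the Cauchy law gives to the values
    above [y] ([measure_cot_mixture_gt], [atom_mixture_law]).

    The law obtained does not depend on the measure.  For a random measure
    [M] it remains to integrate it over the law of [M], which is legitimate
    because the pair [(M, S)] has a product law, by independence, and because
    the normalised transform is jointly measurable in the pair for the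
    sigma-algebra generated by [M].  The latter holds because the transform is
    a limit of finite sums that involve [M] only through the masses of the
    cells of a grid ([cvg_grid_sum], [measurable_pv_normalized]).  The same
    device shows that the pairs with [S] in the support of [M] form a
    measurable set ([measurable_msupp]); its sections are locally finite, hence
    null. *)

(** * Partial fractions of the cotangent *)

Section Cotangent.
Context {R : realType}.
Implicit Types x y z : R.

Definition cot x : R := cos x / sin x.

Lemma cotN x : cot (- x) = - cot x.
Proof. by rewrite /cot sinN cosN invrN mulrN. Qed.

Lemma cotDpi x : cot (x + pi) = cot x.
Proof. by rewrite /cot sinDpi cosDpi invrN mulrNN. Qed.

Lemma cotB x y : sin x != 0 -> sin y != 0 ->
  cot x - cot y = sin (y - x) / (sin x * sin y).
Proof. by move=> sx sy; rewrite /cot sinB; field; rewrite sx sy. Qed.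

Lemma ltr_cot x y : 0 < x -> x < y -> y < pi -> cot y < cot x.
Proof.
move=> x0 xy ypi.
have sx : 0 < sin x by apply: sin_gt0_pi; rewrite x0 (lt_trans xy).
have sy : 0 < sin y by apply: sin_gt0_pi; rewrite ypi (lt_trans x0).
rewrite -subr_gt0 cotB ?gt_eqF// divr_gt0 ?mulr_gt0//.
by apply: sin_gt0_pi; rewrite subr_gt0 xy/= (le_lt_trans _ ypi)// gerBl ltW.
Qed.

Lemma cos_sin_half_neq0 z : sin z != 0 -> cos (z / 2) != 0 /\ sin (z / 2) != 0.
Proof.
have {1}-> : z = (z / 2) *+ 2 by rewrite -mulr_natr divfK.
move: (z / 2) => h; rewrite sin_mulr2n -mulr_natr !mulf_eq0 !negb_or.
by case/andP => /andP[c0 s0] _.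
Qed.

Lemma cot_double z : sin z != 0 ->
  cot z *+ 2 = cot (z / 2) + cot ((z + pi) / 2).
Proof.
move=> /cos_sin_half_neq0[]; rewrite mulrDl /cot sinDpihalf cosDpihalf.
have zE : z = (z / 2) *+ 2 by rewrite -mulr_natr divfK.
have -> : sin z = (cos (z / 2) * sin (z / 2)) *+ 2 by rewrite -sin_mulr2n -zE.
have -> : cos z = cos (z / 2) ^+ 2 *+ 2 - 1 by rewrite -cos_mulr2n -zE.
move: (z / 2) => h c0 s0.
have -> : cos h ^+ 2 *+ 2 - 1 = cos h ^+ 2 - sin h ^+ 2.
  by have := cos2Dsin2 h; lra.
by field; rewrite c0 s0.
Qed.

Lemma sum_even_odd (f : nat -> R) n :
  \sum_(0 <= k < n.*2) f k = \sum_(0 <= k < n) (f k.*2 + f k.*2.+1).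
Proof.
elim: n => [|n ih]; first by rewrite !big_geq.
by rewrite doubleS !big_nat_recr//= ih addrA.
Qed.

Lemma sum_fold (f : nat -> R) n :
  \sum_(0 <= k < n.*2) f k = \sum_(0 <= k < n) (f k + f (n.*2 - k.+1)%N).
Proof.
rewrite big_split/= (@big_cat_nat _ _ _ n)//=; last by rewrite -addnn leq_addr.
congr (_ + _); rewrite big_nat_rev -{1}[n]add0n big_addn -addnn addnK.
by apply: eq_big_nat => k /andP[_ kn]; congr f; lia.
Qed.

(** The duplication formula [cot_double], iterated.  Powers of two are enough,
    because on half a period the partial sums of the expansion are monotone. *)
Lemma cot_multiple n z : sin z != 0 ->
  cot z * 2 ^+ n = \sum_(0 <= k < 2 ^ n) cot ((z + k%:R * pi) / 2 ^+ n).
Proof.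
elim: n z => [|n ih] z sz.
  by rewrite expr0 mulr1 expn0 big_nat1 mul0r addr0 divr1.
have [c0 s0] := cos_sin_half_neq0 sz.
rewrite exprS mulrA mulr_natr cot_double// mulrDl ih// ih; last first.
  by rewrite mulrDl sinDpihalf.
rewrite expnS mul2n sum_even_odd -big_split/=; apply: eq_bigr => k _.
have n0 : 2 ^+ n != 0 :> R by rewrite expf_neq0.
have kE : k.*2%:R = k%:R * 2 :> R by rewrite -mul2n mulrC natrM.
by congr (cot _ + cot _); rewrite -?natr1 kE; field.
Qed.

Lemma le_sin x : 0 <= x -> sin x <= x.
Proof.
rewrite le_eqVlt => /predU1P[<-|x0]; first by rewrite sin0.
have [|c cx] := @MVT R (@sin R) cos 0 x x0 (fun y _ => is_derive_sin y).
  by apply: continuous_subspaceT => ?; exact: continuous_sin.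
by rewrite sin0 !subr0 => ->; rewrite ler_piMl ?cos_le1// ltW.
Qed.

(** The inequality [x <= tan x], in a form valid beyond [pi / 2]. *)
Lemma mulcos_le_sin x : 0 <= x <= pi -> x * cos x <= sin x.
Proof.
case/andP; rewrite le_eqVlt => /predU1P[<-|x0]; first by rewrite mul0r sin0.
move=> xpi; rewrite -subr_ge0.
have dE (c : R) : is_derive c 1 (fun t => sin t - t * cos t) (c * sin c).
  by apply: is_derive_eq; rewrite /GRing.scale/=; ring.
have [|c cx] := @MVT R _ (fun c => c * sin c) 0 x x0 (fun y _ => dE y).
  by apply: derivable_within_continuous => y _; exact: ex_derive.
rewrite sin0 mul0r !subr0 => ->; move: cx; rewrite in_itv/= => /andP[c0 cx].
by rewrite !mulr_ge0 ?(ltW c0) ?(ltW x0)// sin_ge0_pi// (ltW c0)/= (le_trans (ltW cx)).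
Qed.

Lemma is_derive_cot x : sin x != 0 -> is_derive x 1 cot (- (sin x) ^- 2).
Proof.
move=> sx; have dV := @is_deriveV R sin x _ 1 sx (is_derive_sin x).
have H : is_derive x 1 cot _ := is_deriveM (is_derive_cos x) dV.
apply: is_derive_eq H _.
rewrite /GRing.scale/=; have cs := cos2Dsin2 x.
by rewrite -[X in _ = - X]mul1r -cs; field.
Qed.

(** The derivative [x^-2 - (sin x)^-2] lies between -1 and 0, because
    [(cos x / sin x)^2 <= x^-2 <= (sin x)^-2]. *)
Lemma cotBinv_lipschitz x y : 0 < x <= pi / 2 -> 0 < y <= pi / 2 ->
  `|(cot x - cot y) - (x^-1 - y^-1)| <= `|x - y|.
Proof.
wlog xy : x y / x < y.
  move=> H hx hy; have [xy|xy|->] := ltgtP x y.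
  - exact: H.
  - rewrite -normrN [leRHS]distrC.
    by have := H _ _ xy hy hx; congr (`|_| <= _); ring.
  - by rewrite !subrr normr0.
move=> /andP[x0 _] /andP[y0 ypi].
have pi2 : pi / 2 < pi :> R by have := @pi_gt0 R; lra.
have s0 c : x <= c <= y -> 0 < sin c.
  by move=> /andP[xc cy]; apply: sin_gt0_pi; rewrite (lt_le_trans x0)//=; lra.
have dE (c : R) : x <= c <= y ->
    is_derive c 1 (fun t => cot t - t^-1) (c ^- 2 - (sin c) ^- 2).
  move=> xcy; have c0 : c != 0.
    by case/andP: xcy => xc _; rewrite gt_eqF// (lt_le_trans x0).
  have sc : sin c != 0 by rewrite gt_eqF// s0.
  have dV := @is_deriveV R id c _ 1 c0 (is_derive_id c 1).
  have H : is_derive c 1 (fun t => cot t - t^-1) _ := is_deriveB (is_derive_cot sc) dV.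
  apply: is_derive_eq H _.
  by rewrite /GRing.scale/=; field; rewrite c0 sc.
have [||c cx] := @MVT R (fun t => cot t - t^-1) (fun c => c ^- 2 - (sin c) ^- 2) x y xy.
- by move=> c; rewrite in_itv/= => /andP[? ?]; apply: dE; rewrite !ltW.
- by apply: derivable_within_continuous => c; rewrite in_itv/= => ?; apply: ex_derive;
    exact: dE.
move=> E; rewrite distrC [leRHS]distrC.
rewrite [X in `|X|](_ : _ = (cot y - y^-1) - (cot x - x^-1)); last by ring.
rewrite E normrM ler_piMl//.
move: cx; rewrite in_itv/= => /andP[xc cy].
have c0 : 0 < c by exact: lt_trans xc.
have sc : 0 < sin c by rewrite s0// !ltW.
have sle := le_sin (ltW c0).
have cle : c * cos c <= sin c by apply: mulcos_le_sin; rewrite (ltW c0)/=; lra.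
have cc0 : 0 <= cos c by apply: cos_ge0_pihalf; apply/andP; split; have := @pi_gt0 R; lra.
have i1 : c ^- 2 <= (sin c) ^- 2.
  by rewrite lef_pV2 ?posrE ?exprn_gt0// lerXn2r ?nnegrE// ltW.
have i2 : (sin c) ^- 2 - 1 <= c ^- 2.
  have -> : (sin c) ^- 2 - 1 = (cos c / sin c) ^+ 2.
    have cs : 1 = cos c ^+ 2 + sin c ^+ 2 by rewrite cos2Dsin2.
    by rewrite -[X in X - 1]mul1r {1}cs; field; rewrite gt_eqF.
  rewrite -exprVn lerXn2r ?nnegrE ?divr_ge0 ?invr_ge0 ?(ltW c0) ?(ltW sc)//.
  by rewrite ler_pdivrMr// mulrC ler_pdivlMr// mulrC.
by rewrite ler_norml; apply/andP; split; lra.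
Qed.

(** The poles are taken in the order 0, pi, -pi, 2 pi, ..., so that [n] pairs of
    terms cover [2 n] consecutive multiples of [pi]. *)
Definition pole_sum n z : R :=
  \sum_(0 <= k < n) ((z + k%:R * pi)^-1 + (z - k.+1%:R * pi)^-1).

(** Folding [cot_multiple] around its middle pairs the terms
    [cot a - cot b] with [a - b] of order [2 ^ - n].  Replacing [cot a - cot b]
    by [a^-1 - b^-1] costs [|a - b|] for each of the [2 ^ n] pairs, that is a
    bounded amount, while the whole identity is scaled by [2 ^ n]. *)
Lemma pole_sum_pow2 n z : 0 < z < pi ->
  `|cot z - pole_sum (2 ^ n) z| <= pi / 2 ^+ n.+2.
Proof.
move=> /andP[z0 zpi]; have pi0 := @pi_gt0 R.
have N0 : 0 < 2 ^+ n.+1 :> R by rewrite exprn_gt0.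
have sz : sin z != 0 by rewrite gt_eqF// sin_gt0_pi// z0.
have NE : 2 ^+ n.+1 = (2 ^ n)%:R * 2 :> R by rewrite exprSr natrX.
suff : `|(cot z - pole_sum (2 ^ n) z) * 2 ^+ n.+1| <= pi / 2.
  rewrite normrM [`|2 ^+ _|]gtr0_norm// -ler_pdivlMr// => /le_trans; apply.
  by rewrite [in leRHS]exprS invfM mulrA.
rewrite mulrBl cot_multiple// expnS mul2n sum_fold mulr_suml -sumrB.
apply: (le_trans (ler_norm_sum _ _ _)).
have -> : pi / 2 = \sum_(0 <= k < 2 ^ n) pi / 2 ^+ n.+1 :> R.
  rewrite sumr_const_nat subn0 -[RHS]mulr_natr NE; field.
  by rewrite pnatr_eq0 expn_eq0.
rewrite !big_nat; apply: ler_sum => k /andP[_ kn].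
set a := (z + k%:R * pi) / 2 ^+ n.+1.
set b := (k.+1%:R * pi - z) / 2 ^+ n.+1.
have kN : k%:R + 1 <= (2 ^ n)%:R :> R by rewrite natr1 ler_nat.
have k0 : 0 <= k%:R :> R by [].
have kpi : (k%:R + 1) * pi <= (2 ^ n)%:R * pi :> R.
  by rewrite ler_wpM2r ?(ltW pi0).
have kpi0 : 0 <= k%:R * pi :> R by rewrite mulr_ge0// ltW.
have aI : 0 < a <= pi / 2.
  rewrite divr_gt0//=; last by lra.
  rewrite ler_pdivrMr// NE; lra.
have bI : 0 < b <= pi / 2.
  rewrite /b -natr1 divr_gt0//=; last by lra.
  rewrite ler_pdivrMr// NE; lra.
have cE : cot ((z + ((2 ^ n).*2 - k.+1)%:R * pi) / 2 ^+ n.+1) = - cot b.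
  rewrite -cotN -(cotDpi (- b)) natrB; last by lia.
  congr cot; rewrite -mul2n natrM NE /b NE; field.
  by rewrite pnatr_eq0 expn_eq0.
rewrite cE.
have -> : ((z + k%:R * pi)^-1 + (z - k.+1%:R * pi)^-1) * 2 ^+ n.+1 = a^-1 - b^-1.
  by rewrite /a /b !invfM !invrK -opprB invrN; ring.
apply: le_trans (cotBinv_lipschitz aI bI) _.
rewrite /a /b -mulrBl normrM normfV [`|2 ^+ _|]gtr0_norm// ler_pM2r ?invr_gt0//.
by rewrite ler_norml -natr1; apply/andP; split; lra.
Qed.

Lemma pole_sumN n z : pole_sum n (pi - z) = - pole_sum n z.
Proof.
rewrite /pole_sum -sumrN; apply: eq_bigr => k _.
by rewrite opprD -!invrN addrC -natr1; congr (_^-1 + _^-1); ring.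
Qed.

(** On this interval all the pairs of terms are nonnegative, so convergence
    along the powers of two gives convergence. *)
Lemma cvg_pole_sum_half z : 0 < z <= pi / 2 ->
  pole_sum n z @[n --> \oo] --> cot z.
Proof.
move=> /andP[z0 zpi]; have pi0 := @pi_gt0 R.
have zI : 0 < z < pi by rewrite z0/=; lra.
have nd : {homo (fun n => pole_sum n z) : n m / (n <= m)%N >-> n <= m}.
  apply/nondecreasing_seqP => n; rewrite /pole_sum big_nat_recr//= lerDl.
  have n0 : 0 <= n%:R * pi :> R by rewrite mulr_ge0// ltW.
  rewrite -natr1 -[(z - _)^-1]opprK -invrN opprB.
  rewrite subr_ge0 lef_pV2 ?posrE; lra.
have p2 : pole_sum (2 ^ n) z @[n --> \oo] --> cot z.
  apply/cvgrPdist_le => e e0; near=> n.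
  apply: le_trans (pole_sum_pow2 n zI) _.
  rewrite ler_pdivrMr ?exprn_gt0// mulrC -ler_pdivrMr//.
  apply: (@le_trans _ _ n%:R); last by rewrite -natrX ler_nat;
    have := ltn_expl n (ltnSn 1); rewrite !expnS; lia.
  near: n; exact: (cvgryPge _).1 cvgr_idn _.
have cv : cvgn (fun n => pole_sum n z).
  apply: nondecreasing_is_cvgn => //; exists (cot z + pi) => _ [n _ <-].
  apply: (le_trans (nd _ _ (ltnW (ltn_expl n (ltnSn 1))))).
  have := pole_sum_pow2 n zI; rewrite ler_distlC => /andP[_ /le_trans]; apply.
  by rewrite lerD2l ler_pdivrMr ?exprn_gt0// ler_peMr ?(ltW pi0)// exprn_ege1// ler1n.
have sub : pole_sum (2 ^ n) z @[n --> \oo] --> limn (fun n => pole_sum n z).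
  apply: (cvg_comp _ _ _ cv) => //.
  apply/cvgnyPge => A; near=> n; apply: leq_trans (ltnW (ltn_expl n (ltnSn 1))).
  by near: n; exact: nbhs_infty_ge.
by rewrite (cvg_unique _ p2 sub).
Unshelve. all: end_near. Qed.

Lemma cvg_inv_affine (a c : R) : c != 0 -> (a + n%:R * c)^-1 @[n --> \oo] --> (0 : R).
Proof.
wlog c0 : a c / 0 < c.
  move=> H cn0; have [c0|c0|c0] := ltgtP c 0; last by rewrite c0 eqxx in cn0.
  - have := H (- a) (- c); rewrite oppr_gt0 oppr_eq0 => /(_ c0 cn0)/cvgN.
    rewrite oppr0; apply: cvg_trans; apply: near_eq_cvg; near=> n.
    rewrite -[RHS]opprK -invrN.
    by rewrite opprD -mulrN.
  - exact: H.
have ge A : \forall n \near \oo, A <= a + n%:R * c.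
  near=> n; rewrite addrC -lerBlDr -ler_pdivrMr//.
  near: n; exact: (cvgryPge _).1 cvgr_idn _.
move=> _; apply/gtr0_cvgV0; last exact/cvgryPge.
by near=> n; rewrite (@lt_le_trans _ _ 1)//; near: n; exact: ge.
Unshelve. all: end_near. Qed.

Lemma cvg_pole_sum0 : pole_sum n 0 @[n --> \oo] --> cot 0.
Proof.
have E n : pole_sum n 0 = - (n%:R * pi)^-1.
  elim: n => [|n ih]; first by rewrite /pole_sum big_geq// mul0r invr0 oppr0.
  rewrite /pole_sum big_nat_recr//= -/(pole_sum n 0) ih !add0r invrN.
  by rewrite addrA addNr add0r.
rewrite /cot sin0 invr0 mulr0 -[X in _ --> X]oppr0.
under eq_fun do rewrite E -[_ * pi]add0r.
by apply: cvgN; apply: cvg_inv_affine; rewrite gt_eqF// pi_gt0.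
Qed.

(** The difference of the sums at [z + pi] and [z] telescopes; this carries
    the expansion from one period to the whole line. *)
Lemma pole_sumDpi n z :
  pole_sum n (z + pi) = pole_sum n z + ((z + n%:R * pi)^-1 - (z - n%:R * pi)^-1).
Proof.
elim: n => [|n ih]; first by rewrite /pole_sum !big_geq// mul0r addr0 subr0 subrr addr0.
rewrite {1}/pole_sum big_nat_recr//= -/(pole_sum n (z + pi)) ih.
rewrite [in RHS]/pole_sum big_nat_recr//= -/(pole_sum n z).
have -> : z + pi + n%:R * pi = z + n.+1%:R * pi by rewrite -natr1; ring.
have -> : z + pi - n.+1%:R * pi = z - n%:R * pi by rewrite -natr1; ring.
by ring.
Qed.

Lemma cvg_pole_sumDpi z :
  pole_sum n (z + pi) @[n --> \oo] --> cot (z + pi) <->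
  pole_sum n z @[n --> \oo] --> cot z.
Proof.
have pin0 : pi != 0 :> R by rewrite gt_eqF// pi_gt0.
have d0 : (z + n%:R * pi)^-1 - (z - n%:R * pi)^-1 @[n --> \oo] --> (0 : R).
  rewrite -[0]subr0; apply: cvgB; first exact: cvg_inv_affine.
  by under eq_fun do rewrite -mulrN; apply: cvg_inv_affine; rewrite oppr_eq0.
rewrite cotDpi; split => H.
- rewrite -[cot z]subr0 (_ : pole_sum^~ z = fun n => pole_sum n (z + pi) -
    ((z + n%:R * pi)^-1 - (z - n%:R * pi)^-1)); first exact: cvgB.
  by apply/funext => n; rewrite pole_sumDpi addrK.
- rewrite -[cot z]addr0; under eq_fun do rewrite pole_sumDpi.
  exact: cvgD.
Qed.

(** Poles are not excluded: there the term [0^-1] is 0, the other terms cancel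
    in the limit, and [cos z / sin z] is 0 as well. *)
Theorem cvg_pole_sum z : pole_sum n z @[n --> \oo] --> cot z.
Proof.
have pi0 := @pi_gt0 R.
have base : forall y, 0 <= y < pi -> pole_sum n y @[n --> \oo] --> cot y.
  move=> y /andP[]; rewrite le_eqVlt => /predU1P[<- _|y0 ypi].
    exact: cvg_pole_sum0.
  have [yh|yh] := leP y (pi / 2); first by apply: cvg_pole_sum_half; rewrite y0.
  have : pole_sum n (pi - y) @[n --> \oo] --> cot (pi - y).
    by apply: cvg_pole_sum_half; apply/andP; split; lra.
  rewrite [in cot _]addrC cotDpi cotN => /cvgN; rewrite opprK; apply: cvg_trans.
  by apply: near_eq_cvg; near=> n; rewrite -[RHS]opprK -pole_sumN.
have nat (y : R) k : pole_sum n y @[n --> \oo] --> cot y <->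
    pole_sum n (y + k%:R * pi) @[n --> \oo] --> cot (y + k%:R * pi).
  elim: k => [|k ih]; first by rewrite mul0r addr0.
  rewrite ih -natr1 mulrDl mul1r addrA; split => H; exact/cvg_pole_sumDpi.
pose j := Num.floor (z / pi); pose r := z - j%:~R * pi.
have rI : 0 <= r < pi.
  have := floor_itv (z / pi); rewrite -/j intrD ler_pdivlMr// ltr_pdivrMr//.
  by rewrite mulrDl mul1r /r => /andP[? ?]; apply/andP; split; lra.
have zE : z = r + j%:~R * pi by rewrite /r subrK.
have rP := base _ rI.
rewrite zE; case: (j) => k; first exact/(nat r k).
rewrite NegzE mulrNz mulNr; apply/(nat _ k.+1).
by rewrite subrK.
Unshelve. all: end_near. Qed.

End Cotangent.

(** * The sum of the roots of a cotangent equation *)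

(** With [u = exp (2 i t)] and [q_j = exp (2 i a_j)] one has
    [cot (t - a_j) = i (u + q_j) / (u - q_j)].  Hence the points [exp (2 i t_i)]
    are [n] distinct roots of the polynomial [P] of degree [n] obtained by
    clearing denominators, and comparing [P] at 0 with the product of its roots
    relates the sum of the [t_i] to the sum of the [a_j].  The conclusion says
    that the cotangent of the difference of the two sums is [y]. *)
Lemma cos_sum_roots (R : realType) n (p a t : 'I_n -> R) (y : R) :
  \sum_i p i = 1 -> (forall i j, sin (t i - a j) != 0) ->
  (forall i j, i != j -> sin (t i - t j) != 0) ->
  (forall i, \sum_j p j * cot (t i - a j) = y) ->
  cos (\sum_i (t i - a i)) = y * sin (\sum_i (t i - a i)).
Proof.
move=> p1 ta tt ty.
pose e (s : R) : R[i] := (cos s +i* sin s)%C.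
have eD s s' : e (s + s') = e s * e s'.
  by rewrite /e sinD cosD; simpc; congr (_ +i* _)%C; ring.
have e0 : e 0 = 1 by rewrite /e sin0 cos0.
have eB s s' : e (s *+ 2) - e (s' *+ 2) = 'i%C * (2 * sin (s - s'))%:C%C * e (s + s').
  have -> : s *+ 2 = (s + s') + (s - s') by ring.
  have -> : s' *+ 2 = (s + s') - (s - s') by ring.
  move: (s + s') (s - s') => A D; rewrite /e !cosD !sinD cosN sinN.
  by simpc; congr (_ +i* _)%C; ring.
have eA s s' : e (s *+ 2) + e (s' *+ 2) = (2 * cos (s - s'))%:C%C * e (s + s').
  have -> : s *+ 2 = (s + s') + (s - s') by ring.
  have -> : s' *+ 2 = (s + s') - (s - s') by ring.
  move: (s + s') (s - s') => A D; rewrite /e !cosD !sinD cosN sinN.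
  by simpc; congr (_ +i* _)%C; ring.
pose u i := e (t i *+ 2); pose q j := e (a j *+ 2).
have eq0 s : e s != 0.
  by apply/eqP => /eqP h; have := eD s (- s); rewrite subrr e0 (eqP h) mul0r => /eqP;
    rewrite oner_eq0.
have uq i j : 'i%C * (u i + q j) = (cot (t i - a j))%:C%C * (u i - q j).
  rewrite /u /q eA eB /cot !mulrA; congr (_ * _).
  by simpc; congr (_ +i* _)%C; field.
have uinj i j : i != j -> u i != u j.
  move=> ij; rewrite -subr_eq0 /u eB !mulf_neq0//.
    by rewrite eq_complex /= eqxx oner_eq0.
  by rewrite eq_complex /= eqxx andbT mulf_neq0// tt.
pose Q := \prod_k ('X - (q k)%:P).
pose Qj j := \prod_(k | k != j) ('X - (q k)%:P).
have QE j : Q = ('X - (q j)%:P) * Qj j by rewrite /Q (bigD1 j).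
pose P : {poly R[i]} := \sum_j ('i * (p j)%:C)%C *: (('X + (q j)%:P) * Qj j) - (y%:C)%C
  *: Q.
have rP i : root P (u i).
  rewrite /root /P hornerD hornerN horner_sum hornerZ subr_eq0; apply/eqP.
  rewrite -{1}(ty i) raddf_sum/= mulr_suml; apply: eq_bigr => j _.
  rewrite (QE j) hornerZ !hornerM hornerD hornerXsubC hornerX hornerC.
  rewrite rmorphM/= !mulrA; congr (_ * _).
  by rewrite -[RHS]mulrA -uq mulrCA mulrA.
have sQ : size Q = n.+1 by rewrite size_prod_XsubC /index_enum -enumT size_enum_ord.
have mQ : Q \is monic by exact: monic_prod_XsubC.
have pC : \sum_j (p j)%:C%C = 1 :> R[i] by rewrite -rmorph_sum/= p1 rmorph1.
(* Since [X + q_j = (X - q_j) + 2 q_j] and the weights add up to 1, [P] is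
   [(i - y) Q] up to terms of smaller degree. *)
pose L := \sum_j ('i * (p j)%:C)%C *: ((2 * q j)%:P * Qj j).
have PL : P = ('i - y%:C)%C *: Q + L.
  rewrite /P scalerBl addrAC; congr (_ - _).
  have -> : 'i%C *: Q = \sum_j ('i * (p j)%:C)%C *: Q.
    by rewrite -scaler_suml -mulr_sumr pC mulr1.
  rewrite /L -big_split/=; apply: eq_bigr => j _; rewrite -scalerDr; congr (_ *: _).
  by rewrite (QE j) -mulrDl; congr (_ * _); rewrite polyCM; ring.
have iy0 : ('i - y%:C)%C != 0 :> R[i] by rewrite eq_complex/= subr0 oner_eq0 andbF.
have sQj j : size (Qj j) = n.
  have := sQ; rewrite (QE j) mulrC size_Mmonic ?monicXsubC//; last first.
    exact/monic_neq0/monic_prod_XsubC.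
  by rewrite size_XsubC addn2 => -[].
have sL : (size L <= n)%N.
  apply: leq_trans (size_sum _ _ _) _; apply/bigmax_leqP => j _.
  apply: leq_trans (size_scale_leq _ _) _.
  by rewrite mul_polyC -[leqRHS](sQj j) size_scale_leq.
have sP : size P = n.+1 by rewrite PL size_polyDl size_scale// sQ.
have lP : lead_coef P = ('i - y%:C)%C.
  rewrite PL lead_coefDl ?size_scale ?sQ//.
  by rewrite lead_coefZ (monicP mQ) mulr1.
have PE : P = lead_coef P *: \prod_(z <- [seq u i | i <- enum 'I_n]) ('X - z%:P).
  apply: all_roots_prod_XsubC.
  - by rewrite sP size_map size_enum_ord.
  - by apply/allP => _ /mapP[i _ ->].
  - rewrite uniq_rootsE map_inj_uniq ?enum_uniq// => i j; apply: contra_eq; exact: uinj.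
have prodN (v : 'I_n -> R[i]) : (\prod_i ('X - (v i)%:P)).[0] = (-1) ^+ n * \prod_i v i.
  rewrite horner_prod; under eq_bigr do rewrite hornerXsubC sub0r.
  by rewrite prodrN cardT size_enum_ord.
have := congr1 (fun r => r.[0]) PE.
rewrite lP hornerZ big_map big_enum /= prodN.
rewrite hornerD hornerN horner_sum hornerZ prodN.
have -> : \sum_j (('i * (p j)%:C)%C *: (('X + (q j)%:P) * Qj j)).[0] =
  - 'i%C * ((-1) ^+ n * \prod_i q i).
  rewrite -prodN -[RHS]mulr1 -pC mulr_sumr.
  apply: eq_bigr => j _; rewrite -/Q (QE j) hornerZ !hornerM hornerD hornerXsubC
    hornerX hornerC.
  by rewrite add0r sub0r !mulNr mulrN mulNr opprK mulrAC.
have s0 : (-1) ^+ n != 0 :> R[i] by rewrite expf_neq0// oppr_eq0 oner_eq0.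
rewrite -mulrBl mulrCA [RHS]mulrCA => /(mulfI s0).
have prodE (v : 'I_n -> R) : \prod_i e (v i *+ 2) = e ((\sum_i v i) *+ 2).
  by rewrite -sumrMnl; apply/esym/(big_morph e eD e0).
rewrite !prodE sumrB; move: (\sum_i t i) (\sum_i a i) => A A' /(congr1 (fun z =>
  z * e (- A - A'))).
(* The factor is chosen so that both sides become symmetric in [A - A'], whose
   imaginary parts then give the conclusion. *)
rewrite -!mulrA -!eD.
have -> : A' *+ 2 + (- A - A') = - (A - A') by ring.
have -> : A *+ 2 + (- A - A') = A - A' by ring.
rewrite /e cosN sinN => /(congr1 (fun z => complex.Im z)) /=.
by lra.
Qed.

(** * Level sets of a mixture of cotangents *)

(** Writing [x^-1] as [x * (x ^ 2)^-1] reduces to powers of nonnegative numbers,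
    and gives the right value at 0. *)
Lemma measurable_invr (R : realType) : measurable_fun [set: R] (@GRing.inv R).
Proof.
rewrite (_ : @GRing.inv R = (fun x => x * ((x ^+ 2) `^ (-1)))).
  apply: measurable_funM => //.
  apply: (@measurableT_comp _ _ _ R R R (fun x => x `^ (-1)) _ (fun x => x ^+ 2)).
    exact: measurable_powR.
  exact: exprn_measurable.
apply/funext => x; rewrite powR_inv1 ?sqr_ge0//.
have [->|x0] := eqVneq x 0; first by rewrite invr0 mul0r.
by field.
Qed.

Lemma measurable_cot (R : realType) : measurable_fun [set: R] (@cot R).
Proof.
apply: measurable_funM.
  by apply: continuous_measurable_fun; exact: continuous_cos.
apply: (@measurableT_comp _ _ _ R R R (@GRing.inv R)).
  exact: measurable_invr.
by apply: continuous_measurable_fun; exact: continuous_sin.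
Qed.

Lemma continuous_cot (R : realType) (x : R) : sin x != 0 -> {for x, continuous (@cot R)}.
Proof.
move=> sx; apply: differentiable_continuous; apply/derivable1_diffP.
by have [] := is_derive_cot sx.
Qed.

Lemma cot_arccot (R : realType) (y : R) : cot (pi / 2 - atan y) = y.
Proof.
by rewrite /cot addrC cosDpihalf sinDpihalf sinN opprK cosN -/(tan _) atanK.
Qed.

Lemma arccot_itv (R : realType) (y : R) : 0 < pi / 2 - atan y < pi.
Proof. by have := atan_gtNpi2 y; have := atan_ltpi2 y; lra. Qed.

Lemma sin_neq0_lt_pi (R : realType) (x : R) : 0 < `|x| < pi -> sin x != 0.
Proof.
move=> /andP[x0 xpi]; have [p|n] := lerP 0 x.
  by rewrite gt_eqF// sin_gt0_pi//; move: x0 xpi; rewrite ger0_norm// => -> ->.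
rewrite -oppr_eq0 -sinN gt_eqF// sin_gt0_pi//.
by move: x0 xpi; rewrite ltr0_norm// => -> ->.
Qed.

Section Gaps.
Context {R : realType}.
Variables (B : R) (n : nat) (x p : nat -> R).
Hypothesis B0 : 0 < B.
Hypothesis xS : forall i, (i < n)%N -> x i < x i.+1.
Hypothesis xn : x n = x 0%N + B.
Hypothesis p0 : forall i, (i < n)%N -> 0 < p i.
Hypothesis p1 : \sum_(i < n) p i = 1.

Let c : R := pi / B.

Let c0 : 0 < c.
Proof. by rewrite divr_gt0// pi_gt0. Qed.

Let cB : c * B = pi.
Proof. by rewrite divfK// gt_eqF. Qed.

Definition cot_mixture (s : R) : R := \sum_(i < n) p i * cot (c * (s - x i)).
Let G := cot_mixture.

Lemma points_le i j : (i <= j <= n)%N -> x i <= x j.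
Proof.
move=> /andP[]; elim: j => [|j ih]; first by rewrite leqn0 => /eqP ->.
rewrite leq_eqVlt => /predU1P[->//|ij jn].
by rewrite (le_trans (ih _ (ltnW jn)))// ltW// xS.
Qed.

(** Since [x n = x 0 + B], a gap lies less than one period away from every [x j];
    comparing the indices tells on which side. *)
Lemma gap_scaled_dist i j s : (i < n)%N -> (j < n)%N -> x i < s < x i.+1 ->
  if (j <= i)%N then 0 < c * (s - x j) < pi else - pi < c * (s - x j) < 0.
Proof.
move=> iN jn /andP[s1 s2]; rewrite -cB.
have [ji|ij] := leqP j i.
  rewrite mulr_gt0//=; last by rewrite subr_gt0 (le_lt_trans _ s1)// points_le// ji ltnW.
  rewrite ltr_pM2l// ltrBlDr; apply: (lt_le_trans s2).
  apply: (@le_trans _ _ (x n)); first by rewrite points_le// iN leqnn.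
  by rewrite xn addrC lerD2l points_le// leq0n ltnW.
rewrite pmulr_rlt0// subr_lt0 (lt_le_trans s2)/=; last by rewrite points_le// ij ltnW.
rewrite -mulrN ltr_pM2l// andbT ltrBrDr; apply: le_lt_trans s1.
apply: (@le_trans _ _ (x 0%N)); last by rewrite points_le// leq0n ltnW.
by rewrite addrC lerBlDr -xn points_le// leqnn ltnW.
Qed.

Lemma gap_sin_neq0 i j s : (i < n)%N -> (j < n)%N -> x i < s < x i.+1 ->
  sin (c * (s - x j)) != 0.
Proof.
move=> iN jn sI; have := gap_scaled_dist iN jn sI.
case: ifP => _ /andP[h1 h2]; apply: sin_neq0_lt_pi.
  by rewrite gtr0_norm// h1.
by rewrite ltr0_norm// oppr_gt0 h2/= ltrNl.
Qed.

Lemma gap_cot_decr i j s t : (i < n)%N -> (j < n)%N ->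
  x i < s -> s < t -> t < x i.+1 -> cot (c * (t - x j)) < cot (c * (s - x j)).
Proof.
move=> iN jn xs st tx.
have hs := @gap_scaled_dist i j s iN jn; rewrite xs (lt_trans st)// in hs.
have ht := @gap_scaled_dist i j t iN jn; rewrite (lt_trans xs)// tx in ht.
have {hs ht}[hs ht] := (hs isT, ht isT).
have lt : c * (s - x j) < c * (t - x j) by rewrite ltr_pM2l// ltrD2r.
move: hs ht; case: ifP => _ /andP[h1 h2] /andP[h3 h4]; first exact: ltr_cot.
rewrite -(cotDpi (c * (t - _))) -(cotDpi (c * (s - _))).
by apply: ltr_cot; rewrite ?ltrD2r//; lra.
Qed.

Lemma gap_cot_mixture_decr i s t : (i < n)%N ->
  x i < s -> s < t -> t < x i.+1 -> G t < G s.
Proof.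
move=> iN xs st tx; apply: ltr_sum => [|j _].
  by apply/hasP; exists (Ordinal iN); rewrite ?mem_index_enum.
by rewrite ltr_pM2l ?p0// (gap_cot_decr iN).
Qed.

Lemma gap_cot_mixture_continuous i s : (i < n)%N -> x i < s < x i.+1 ->
  {for s, continuous G}.
Proof.
move=> iN sI; apply: cvg_big => [|j _]; first exact: add_continuous.
 apply: cvgM; first exact: cvg_cst.
apply: (@continuous_comp _ _ _ (fun s => c * (s - x j)) (@cot R));
  last exact/continuous_cot/(gap_sin_neq0 iN).
by apply: cvgM; [exact: cvg_cst|apply: cvgB; [exact: cvg_id|exact: cvg_cst]].
Qed.

(** Near the left end of a gap the term of that atom is large while the others
    stay above their value at the midpoint. *)
Lemma gap_large i y : (i < n)%N -> exists2 s, x i < s <= (x i + x i.+1) / 2 & y <= G s.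
Proof.
move=> iN; pose m := (x i + x i.+1) / 2.
have xm : x i < m by rewrite midf_lt// xS.
have mx : m < x i.+1 by rewrite midf_lt// xS.
pose K := \sum_(j < n | j != Ordinal iN) p j * cot (c * (m - x j)).
pose t := (y - K) / p i.
(* At the second argument of the minimum the cotangent of that atom is [t]. *)
pose s := Num.min m (x i + c^-1 * (pi / 2 - atan t)).
have ai := arccot_itv t.
have xs : x i < s by rewrite lt_min xm ltrDl mulr_gt0 ?invr_gt0//; case/andP: ai.
have sm : s <= m by rewrite ge_min lexx.
exists s; first by rewrite xs.
rewrite /G /cot_mixture (bigD1 (Ordinal iN))//=.
apply: (@le_trans _ _ (p i * t + K)).
  by rewrite /t mulrC divfK ?subrK// gt_eqF// p0.
apply: lerD.
  rewrite ler_pM2l ?p0//; rewrite -[leLHS]cot_arccot.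
  have : c * (s - x i) <= pi / 2 - atan t.
    by rewrite mulrC -ler_pdivlMr// mulrC lerBlDl ge_min lexx orbT.
  rewrite le_eqVlt => /predU1P[->//|h]; apply/ltW/ltr_cot => //; last by case/andP: ai.
  by rewrite mulr_gt0// subr_gt0.
apply: ler_sum => j _; rewrite ler_pM2l ?p0//.
move: sm; rewrite le_eqVlt => /predU1P[->//|h].
by apply/ltW/(gap_cot_decr iN).
Qed.

(** The mirror image of [gap_large].  The right end of the last gap is the
    translate of the first atom, so the term to single out has index 0 there. *)
Lemma gap_small i y : (i < n)%N -> exists2 s, (x i + x i.+1) / 2 <= s < x i.+1 & G s <= y.
Proof.
move=> iN; pose m := (x i + x i.+1) / 2.
have xm : x i < m by rewrite midf_lt// xS.
have mx : m < x i.+1 by rewrite midf_lt// xS.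
have n0 : (0 < n)%N by exact: leq_ltn_trans iN.
pose k := if (i.+1 < n)%N then i.+1 else 0%N.
have kn : (k < n)%N by rewrite /k; case: ifP.
have ck s : cot (c * (s - x k)) = cot (c * (s - x i.+1)).
  rewrite /k; case: ltnP => // ni; have -> : i.+1 = n by apply/eqP; rewrite eqn_leq iN ni.
  by rewrite xn -[RHS]cotDpi; congr cot; rewrite -cB; ring.
pose K := \sum_(j < n | j != Ordinal kn) p j * cot (c * (m - x j)).
pose t := (K - y) / p k.
pose s := Num.max m (x i.+1 - c^-1 * (pi / 2 - atan t)).
have ai := arccot_itv t.
have sx : s < x i.+1 by rewrite gt_max mx gtrBl mulr_gt0 ?invr_gt0//; case/andP: ai.
have ms : m <= s by rewrite le_max lexx.
exists s; first by rewrite ms.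
rewrite /G /cot_mixture (bigD1 (Ordinal kn))//= ck.
apply: (@le_trans _ _ (p k * (- t) + K)); last first.
  by rewrite /t mulrN mulrC divfK ?opprB ?subrK// gt_eqF// p0.
apply: lerD.
  rewrite ler_pM2l ?p0// lerNr -cotN -mulrN opprB -[leLHS]cot_arccot.
  have : c * (x i.+1 - s) <= pi / 2 - atan t.
    by rewrite mulrC -ler_pdivlMr// mulrC lerBlDr -lerBlDl le_max lexx orbT.
  rewrite le_eqVlt => /predU1P[->//|h]; apply/ltW/ltr_cot => //; last by case/andP: ai.
  by rewrite mulr_gt0// subr_gt0.
apply: ler_sum => j _; rewrite ler_pM2l ?p0//.
move: ms; rewrite le_eqVlt => /predU1P[->//|h].
by apply/ltW/(gap_cot_decr iN).
Qed.

Lemma gap_root i y : (i < n)%N -> exists s, x i < s < x i.+1 /\ G s = y.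
Proof.
move=> iN.
have [l /andP[xl lm] yl] := gap_large y iN.
have [r /andP[mr rx] yr] := gap_small y iN.
have lr : l <= r := le_trans lm mr.
have [||s] := @IVT R G l r y lr.
- apply: continuous_in_subspaceT => s; rewrite inE/= in_itv/= => /andP[ls sr].
  by apply: (gap_cot_mixture_continuous iN); rewrite (lt_le_trans xl)//= (le_lt_trans sr).
- by rewrite ge_min yr orbT le_max yl.
rewrite in_itv/= => /andP[ls sr] Gs; exists s; split => //.
by rewrite (lt_le_trans xl)//= (le_lt_trans sr).
Qed.

Let mu := @lebesgue_measure R.

Lemma measurable_cot_mixture : measurable_fun [set: R] G.
Proof.
apply: measurable_sum => i; apply: measurable_funM => //.
apply: (@measurableT_comp _ _ _ R R R (@cot R) _ (fun s => c * (s - x i))).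
  exact: measurable_cot.
by apply: measurable_funM => //; exact: measurable_funB.
Qed.

(** In each gap the set where the mixture exceeds [y] reaches from the atom
    to the root of the gap.  The lengths add up to some [T] strictly between 0
    and [B], and [cos_sum_roots] gives [cot (pi T / B) = y]. *)
Lemma measure_cot_mixture_gt y :
  mu ([set s | y < G s] `&` `[x 0%N, x n[) = (B / pi * (pi / 2 - atan y))%:E.
Proof.
have [r rP] : {r : nat -> R & forall i, (i < n)%N -> x i < r i < x i.+1 /\ G (r i) = y}.
  apply: (@choice _ _ (fun i s => (i < n)%N -> x i < s < x i.+1 /\ G s = y)) => i.
  have [iN|] := boolP (i < n)%N; last by exists 0.
  by have [s sP] := gap_root y iN; exists s.
have mG : measurable [set s | y < G s].
  rewrite -[X in measurable X]setTI.
  have := measurable_cot_mixture measurableT (measurable_itv `]y, +oo[).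
  by congr (measurable _); apply/seteqP; split => s /=; rewrite in_itv/= andbT.
have gap i : (i < n)%N -> mu ([set s | y < G s] `&` `[x i, x i.+1[) = (r i - x i)%:E.
  move=> iN; have [/andP[xr rx] Gr] := rP i iN.
  apply/eqP; rewrite eq_le; apply/andP; split.
    have -> : (r i - x i)%:E = mu `[x i, r i[%classic.
      by rewrite /mu lebesgue_measure_itv/= lte_fin xr.
    apply: le_measure; rewrite ?inE//; first exact: measurableI.
    move=> s /= [ys]; rewrite !in_itv/= => /andP[xs sx].
    rewrite xs/= ltNge; apply/negP => rs; move: ys; rewrite -Gr.
    move: rs; rewrite le_eqVlt => /predU1P[->|rs]; first by rewrite ltxx.
    by rewrite ltNge ltW// (gap_cot_mixture_decr iN).
  have -> : (r i - x i)%:E = mu `]x i, r i[%classic.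
    by rewrite /mu lebesgue_measure_itv/= lte_fin xr.
  apply: le_measure; rewrite ?inE//; first exact: measurableI.
  move=> s /=; rewrite !in_itv/= => /andP[xs sr]; split.
    by rewrite -Gr; exact: (gap_cot_mixture_decr iN).
  by rewrite ltW//= (lt_trans sr).
have total k : (k <= n)%N -> mu ([set s | y < G s] `&` `[x 0%N, x k[) =
  (\sum_(i < k) (r i - x i))%:E.
  elim: k => [_|k ih kn]; first by rewrite set_itvco0 setI0 /mu measure0 big_ord0.
  rewrite big_ord_recr/= EFinD -ih ?(ltnW kn)// -gap//.
  rewrite -measureU//; last 3 first.
  - exact: measurableI.
  - exact: measurableI.
  - rewrite setIACA setIid; apply/seteqP; split => // s [_]/=.
    by rewrite !in_itv/= => -[/andP[_ sx] /andP[xs _]]; move: (le_lt_trans xs sx);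
      rewrite ltxx.
  congr (mu _); rewrite -setIUr; congr (_ `&` _); apply/seteqP; split => s /=;
    rewrite !in_itv/=.
    move=> /andP[-> h]; have [_|_] := ltP s (x k); [by left|by right].
  move=> [] /andP[h1 h2]; apply/andP; split => //.
  - by rewrite (lt_trans h2)// xS.
  - by rewrite (le_trans _ h1)// points_le// leq0n ltnW.
rewrite total//; congr (_%:E).
set T := \sum_(i < n) (r i - x i).
have n0 : (0 < n)%N.
  by rewrite lt0n; apply/eqP => n0; move: p1; rewrite n0 big_ord0 => /esym/eqP;
    rewrite oner_eq0.
have T0 : 0 < T.
  have <- : \sum_(i < n) (0 : R) = 0 by rewrite big1.
  apply: ltr_sum => [|i _]; first by apply/hasP; exists (Ordinal n0);
    rewrite ?mem_index_enum.
  by have [/andP[? _] _] := rP i (ltn_ord i); rewrite subr_gt0.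
have TB : T < B.
  have -> : B = \sum_(i < n) (x i.+1 - x i).
    by rewrite -(big_mkord predT (fun i => x i.+1 - x i)) telescope_sumr// xn addrC addKr.
  apply: ltr_sum => [|i _]; first by apply/hasP; exists (Ordinal n0);
    rewrite ?mem_index_enum.
  by have [/andP[_ ?] _] := rP i (ltn_ord i); rewrite ltrD2r.
have rlt i j : (i < j)%N -> (j < n)%N -> 0 < c * (r j - r i) < pi.
  move=> ij jn; have iN := ltn_trans ij jn.
  have [/andP[h1 h2] _] := rP i iN; have [/andP[h3 h4] _] := rP j jn.
  rewrite mulr_gt0//=; last by rewrite subr_gt0 (lt_trans h2)// (le_lt_trans _ h3)//
    points_le// ij ltnW.
  rewrite -cB ltr_pM2l// ltrBlDr (lt_le_trans h4)// (@le_trans _ _ (x n))//.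
    by rewrite points_le// jn leqnn.
  by rewrite xn addrC lerD2l ltW// (le_lt_trans _ h1)// points_le// leq0n ltnW.
have := @cos_sum_roots R n (fun i => p i) (fun i => c * x i) (fun i => c * r i) y p1.
have -> : \sum_(i < n) (c * r i - c * x i) = c * T.
  by rewrite mulr_sumr; apply: eq_bigr => i _; rewrite mulrBr.
move=> /(_ _ _ _)/wrap[].
- move=> i j; rewrite -mulrBr; apply: (gap_sin_neq0 (ltn_ord i)) => //.
  exact: (rP i _).1.
- move=> i j ij; rewrite -mulrBr; apply: sin_neq0_lt_pi.
  have [lt|lt|e] := ltngtP i j.
  + have := rlt _ _ lt (ltn_ord j) => /andP[h1 h2].
    by rewrite -normrN -mulrN opprB gtr0_norm// h1.
  + by have := rlt _ _ lt (ltn_ord i) => /andP[h1 h2]; rewrite gtr0_norm// h1.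
  + by move: ij; rewrite (ord_inj e) eqxx.
- move=> i; rewrite -[RHS](rP i (ltn_ord i)).2; apply: eq_bigr => j _.
  by rewrite mulrBr.
move=> E.
have cT : 0 < c * T < pi by rewrite mulr_gt0//= -cB ltr_pM2l.
have sT : sin (c * T) != 0 by rewrite gt_eqF// sin_gt0_pi.
have cotT : cot (c * T) = y by rewrite /cot E mulfK.
suff <- : c * T = pi / 2 - atan y.
  have pin0 : pi != 0 :> R by rewrite gt_eqF// pi_gt0.
  by rewrite /c !mulrA divfK// divff ?mul1r// gt_eqF.
have /andP[a1 a2] := arccot_itv y; have aE := cot_arccot y.
case/andP: cT => t1 t2.
have [h|h|//] := ltgtP (c * T) (pi / 2 - atan y).
- by have := ltr_cot t1 h a2; rewrite cotT aE ltxx.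
- by have := ltr_cot a1 h t2; rewrite cotT aE ltxx.
Qed.

End Gaps.

(** * The Cauchy law and Lebesgue measure on the line *)

Section ImageMeasure.
Context d d' (T1 : measurableType d) (T2 : measurableType d') (R : realType).
Variables (m : {measure set T1 -> \bar R}) (f : T1 -> T2).
Hypothesis mf : measurable_fun setT f.

(** The image measure with the measurability of [f] as an explicit argument,
    so that it can be used where a bundled measure is expected. *)
Definition image_measure : {measure set T2 -> \bar R} :=
  measure_function_pushforward__canonical__measure_function_Measure m mf.

End ImageMeasure.

Section CauchyLaw.
Context {R : realType}.
Local Notation mu := (@lebesgue_measure R).

Definition cauchy_pdf (x : R) : R := (pi * (1 + x ^+ 2))^-1.

Let cauchy_pdf_ge0 x : 0 <= cauchy_pdf x.
Proof. by rewrite invr_ge0 mulr_ge0 ?pi_ge0// addr_ge0// sqr_ge0. Qed.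

Lemma continuous_cauchy_pdf : continuous cauchy_pdf.
Proof.
move=> x; apply: cvgV.
  by rewrite mulf_neq0// ?gt_eqF ?pi_gt0// ltr_pwDl// sqr_ge0.
apply: cvgM; first exact: cvg_cst.
exact: (@continuous_oneDsqr R).
Qed.

Lemma measurable_cauchy_pdf : measurable_fun setT (EFin \o cauchy_pdf).
Proof.
apply/measurable_EFinP; apply: continuous_measurable_fun.
exact: continuous_cauchy_pdf.
Qed.

Let cauchy0 : @cauchy_law R set0 = 0%E.
Proof. by rewrite /cauchy_law integral_set0. Qed.

Let cauchy_ge0 (U : set R) : (0 <= cauchy_law U)%E.
Proof. by apply: integral_ge0 => x _; rewrite lee_fin; exact: cauchy_pdf_ge0. Qed.

Let cauchy_sigma_additive : semi_sigma_additive (@cauchy_law R).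
Proof.
move=> /= F mF tF mUF; rewrite /cauchy_law; apply: cvg_toP.
  apply: ereal_nondecreasing_is_cvgn => m n mn.
  by apply: lee_sum_nneg_natr => // k _ _; exact: cauchy_ge0.
rewrite ge0_integral_bigcup//=.
- by apply: measurable_funTS; exact: measurable_cauchy_pdf.
- by move=> x _; rewrite lee_fin; exact: cauchy_pdf_ge0.
Qed.

HB.instance Definition _ := isMeasure.Build _ _ _ (@cauchy_law R)
  cauchy0 cauchy_ge0 cauchy_sigma_additive.

Lemma cauchy_law_itv y :
  @cauchy_law R `]y, +oo[ = (pi^-1 * (pi / 2 - atan y))%:E.
Proof.
rewrite /cauchy_law integral_itv_obnd_cbnd; last first.
  by apply: measurable_funTS; exact: measurable_cauchy_pdf.
rewrite (@ge0_continuous_FTC2y _ cauchy_pdf (fun x => pi^-1 * atan x) y (pi^-1 * (pi / 2))).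
- by rewrite -EFinB mulrBr.
- by move=> x _; exact: cauchy_pdf_ge0.
- by apply: continuous_subspaceT; exact: continuous_cauchy_pdf.
- by apply: cvgM; [exact: cvg_cst|exact: cvgy_atan].
- by move=> x _; apply: derivableM => //; exact: derivable_atan.
- apply: cvgM; first exact: cvg_cst.
  by apply: cvg_at_right_filter; exact: continuous_atan.
- move=> x _; rewrite derive1E; apply: derive_val.
  by apply: is_derive_eq; rewrite /GRing.scale/= /cauchy_pdf invfM; ring.
Qed.

(** The rays [`]y, +oo[] form a pi-system generating the Borel sets. *)
Lemma measure_eq_rays (m1 m2 : {measure set R -> \bar R}) :
  (forall y, m1 `]y, +oo[%classic = m2 `]y, +oo[%classic) ->
  (forall y, (m1 `]y, +oo[%classic < +oo)%E) ->
  forall E, measurable E -> m1 E = m2 E.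
Proof.
move=> m12 fin; apply: (@measure_unique _ _ _ (@RGenOInfty.G R) (fun k =>
  `](- k%:R), +oo[%classic)).
- exact: RGenOInfty.measurableE.
- move=> _ _ [x ->] [y ->]; exists (Num.max x y).
  apply/seteqP; split => z /=; rewrite !in_itv/= !andbT gt_max.
    by move=> [-> ->].
  by move=> /andP[-> ->].
- by move=> k; exists (- k%:R).
- apply/seteqP; split => // x _; exists (Num.bound `|x|) => //=.
  by rewrite in_itv/= andbT ltrNl (le_lt_trans (ler_norm _))// normrN archi_boundP.
- by move=> _ [y ->]; exact: m12.
- by move=> k; exact: fin.
Qed.

Lemma lebesgue_measure_shift (b : R) (E : set R) : measurable E ->
  mu [set x | E (x + b)] = mu E.
Proof.
move=> mE; have ms : measurable_fun setT (fun x : measurableTypeR R =>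
  (x + b : measurableTypeR R)).
  by apply: measurable_funD.
rewrite [RHS](@lebesgue_measure_unique R (image_measure mu ms))// => X.
move=> /ocitvP[->|[[u v] /= uv ->]]; first by rewrite !measure0.
rewrite [RHS](_ : _ = mu ((fun x => x + b) @^-1` `]u, v]))//.
have -> : (fun x => x + b) @^-1` `]u, v] = `](u - b), (v - b)]%classic.
  by apply/seteqP; split => x /=; rewrite !in_itv/= ltrBlDr lerBrDr.
rewrite !lebesgue_measure_itv/= !lte_fin uv ltrBlDr subrK uv -!EFinB.
by congr (_%:E); ring.
Qed.

(** A shift [h] of at most one period moves the beginning of the window, of
    length [h], to its end; larger shifts are multiples of such ones. *)
Lemma lebesgue_measure_period (B : R) (Q : set R) a b : 0 < B -> measurable Q ->
  (forall s, Q (s + B) <-> Q s) ->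
  mu (Q `&` `[a, a + B[) = mu (Q `&` `[b, b + B[).
Proof.
move=> B0 mQ QB.
have step u h : 0 <= h <= B ->
    mu (Q `&` `[u, u + B[) = mu (Q `&` `[u + h, u + h + B[).
  move=> /andP[h0 hB].
  have -> : Q `&` `[u, u + B[ = (Q `&` `[u, u + h[) `|` (Q `&` `[u + h, u + B[).
    rewrite -setIUr; congr (_ `&` _); apply/seteqP; split => s /=; rewrite !in_itv/=.
      by move=> /andP[-> ->]; have [?|?] := ltP s (u + h); [left|right].
    by move=> [] /andP[h1 h2]; apply/andP; split; lra.
  have -> : Q `&` `[u + h, u + h + B[ =
    (Q `&` `[u + B, u + h + B[) `|` (Q `&` `[u + h, u + B[).
    rewrite -setIUr; congr (_ `&` _); apply/seteqP; split => s /=; rewrite !in_itv/=.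
      by move=> /andP[-> ->]; have [?|?] := ltP s (u + B); [right|left].
    by move=> [] /andP[h1 h2]; apply/andP; split; lra.
  rewrite !measureU//; try exact: measurableI.
  - congr (_ + _)%E; transitivity (mu [set s | (Q `&` `[u + B, u + h + B[) (s + B)]);
      last first.
      by apply: lebesgue_measure_shift; exact: measurableI.
    congr (mu _); apply/seteqP; split => s /=; rewrite !in_itv/=.
      by move=> [/QB Qs /andP[h1 h2]]; split => //; apply/andP; split; lra.
    by move=> [/QB Qs /andP[h1 h2]]; split => //; apply/andP; split; lra.
  - apply/seteqP; split => // s /= [[_ +] [_]]; rewrite !in_itv/=.
    by move=> /andP[? ?] /andP[? ?]; lra.
  - apply/seteqP; split => // s /= [[_ +] [_]]; rewrite !in_itv/=.
    by move=> /andP[? ?] /andP[? ?]; lra.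
have steps u h k : 0 <= h <= B ->
    mu (Q `&` `[u, u + B[) = mu (Q `&` `[u + k%:R * h, u + k%:R * h + B[).
  move=> hB; elim: k => [|k ih]; first by rewrite mul0r addr0.
  by rewrite ih (step _ h)// -natr1 mulrDl mul1r addrA.
wlog ab : a b / a <= b.
  by move=> H; have [ab|/ltW ba] := leP a b; [exact: H|apply/esym/H].
pose k := (Num.bound ((b - a) / B)).+1.
have k0 : 0 < k%:R :> R by rewrite ltr0n.
rewrite (steps a ((b - a) / k%:R) k).
  by rewrite mulrC divfK ?gt_eqF// addrC subrK.
rewrite divr_ge0 ?subr_ge0//=.
rewrite ler_pdivrMr// mulrC -ler_pdivrMr//.
apply: le_trans (ltW (archi_boundP _)) _; first by rewrite divr_ge0 ?subr_ge0// ltW.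
by rewrite ler_nat.
Qed.

End CauchyLaw.

(** * Mixtures of cotangents under a uniform variable *)

Section CotMixtureLaw.
Context {R : realType}.
Local Notation mu := (@lebesgue_measure R).

Lemma cot_scaledD (B : R) (s x : R) : B != 0 ->
  cot (pi / B * (s + B - x)) = cot (pi / B * (s - x)).
Proof. by move=> B0; rewrite -[RHS]cotDpi; congr cot; field. Qed.

(** The window is first moved to start at an atom, where [measure_cot_mixture_gt]
    gives the mass of every ray. *)
Lemma cot_mixture_law (B : R) (n : nat) (x p : nat -> R) : 0 < B ->
  (forall i, (i < n)%N -> x i < x i.+1) -> x n = x 0%N + B ->
  (forall i, (i < n)%N -> 0 < p i) -> \sum_(i < n) p i = 1 ->
  forall a (E : set R), measurable E ->
  mu (cot_mixture B n x p @^-1` E `&` `[a, a + B[) = (B%:E * cauchy_law E)%E.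
Proof.
move=> B0 xS xn p0 p1 a E mE; set G := cot_mixture B n x p.
have mG : measurable_fun [set: measurableTypeR R] (G : measurableTypeR R -> R).
  exact: measurable_cot_mixture.
have mGF (F : set R) : measurable F -> measurable (G @^-1` F : set (measurableTypeR R)).
  by move=> mF; rewrite -[X in measurable X]setTI; exact: mG.
rewrite (@lebesgue_measure_period _ B _ a (x 0%N) B0 (mGF _ mE)); last first.
  move=> s; rewrite /= (_ : G (s + B) = G s)//.
  by apply: eq_bigr => i _; rewrite cot_scaledD// gt_eqF.
have mI : measurable (`[x 0%N, x 0%N + B[ : set (measurableTypeR R)) by [].
pose m1 := image_measure (mrestr mu mI) mG.
pose b : {nonneg R} := NngNum (ltW B0).
(* Both sides are evaluated on rays, as finite measures in [E]. *)
pose m2 : {measure set R -> \bar R} := mscale b (@cauchy_law R).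
have E1 F : m1 F = mu (G @^-1` F `&` `[x 0%N, x 0%N + B[) by [].
have E2 F : m2 F = (B%:E * cauchy_law F)%E by [].
rewrite -E1 -E2; apply: measure_eq_rays => // y.
  rewrite E1 E2 cauchy_law_itv -EFinM mulrA -(measure_cot_mixture_gt B0 xS xn p0 p1).
  rewrite xn; congr (mu _); congr (_ `&` _).
  by apply/seteqP; split => s /=; rewrite in_itv/= andbT.
rewrite E1; apply: (@le_lt_trans _ _ (mu `[x 0%N, x 0%N + B[%classic)).
  apply: le_measure; rewrite ?inE//.
  by apply: measurableI => //; exact: mGF.
by rewrite lebesgue_measure_itv/=; case: ifP => _; rewrite -?EFinB ltry.
Qed.

Definition atom_mixture (B : R) (xs : seq R) (w : R -> R) (s : R) : R :=
  \sum_(x <- xs) w x * cot (pi / B * (s - x)).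

(** Sorting the atoms produces the increasing sequence of [cot_mixture_law]; it
    is closed up by the translate of the first atom. *)
Theorem atom_mixture_law (B : R) (xs : seq R) (w : R -> R) : 0 < B ->
  uniq xs -> {in xs, forall x, 0 <= x < B} -> {in xs, forall x, 0 < w x} ->
  \sum_(x <- xs) w x = 1 ->
  forall a (E : set R), measurable E ->
  mu (atom_mixture B xs w @^-1` E `&` `[a, a + B[) = (B%:E * cauchy_law E)%E.
Proof.
move=> B0 uxs xsB w0 w1 a E mE.
pose ys := sort <=%R xs; pose n := size ys.
have ysxs : perm_eq ys xs by rewrite perm_sort.
have lt_ys : sorted <%R ys by rewrite lt_sorted_uniq_le sort_uniq uxs sort_sorted//;
  exact: le_total.
have ysI : {in ys, forall x, 0 <= x < B} by move=> x; rewrite (perm_mem ysxs); exact: xsB.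
have wys : {in ys, forall x, 0 < w x} by move=> x; rewrite (perm_mem ysxs); exact: w0.
have n0 : (0 < n)%N.
  rewrite /n size_sort lt0n; apply/eqP => /size0nil xs0.
  by move: w1; rewrite xs0 big_nil => /esym/eqP; rewrite oner_eq0.
(* The index [n] stands for the first atom of the next period. *)
pose x i := if (i < n)%N then nth 0 ys i else nth 0 ys 0 + B.
pose p i := w (nth 0 ys i).
have xE (i : 'I_n) : x i = nth 0 ys i by rewrite /x ltn_ord.
have sumE (f : R -> R) : \sum_(x <- xs) f x = \sum_(i < n) f (nth 0 ys i).
  by rewrite -(perm_big _ ysxs)/= (big_nth 0) big_mkord.
have -> : atom_mixture B xs w = cot_mixture B n x p.
  apply/funext => s; rewrite /atom_mixture sumE; apply: eq_bigr => i _.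
  by rewrite xE.
apply: cot_mixture_law => //.
- move=> i iN; rewrite /x iN; case: ltnP => h.
    by apply: (sorted_ltn_nth lt_trans 0 lt_ys); rewrite ?inE.
  have /andP[_ h1] := ysI _ (mem_nth 0 iN); have /andP[h2 _] := ysI _ (mem_nth 0 n0).
  by rewrite (lt_le_trans h1)// lerDr.
- by rewrite /x ltnn n0.
- by move=> i iN; apply: wys; exact: mem_nth.
- by rewrite -w1 sumE.
Qed.

(** The case of a single atom: the total mass is the length of a period. *)
Lemma cauchy_law_setT : cauchy_law [set: R] = 1%E.
Proof.
have := @atom_mixture_law 1 [:: 0] (fun=> 1) ltr01 isT _ _ _ 0 setT measurableT.
rewrite preimage_setT setTI mul1e lebesgue_measure_itv/= lte_fin add0r ltr01 sube0.
move=> <- //; last by rewrite big_seq1.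
by move=> x; rewrite inE => /eqP ->; rewrite lexx ltr01.
Qed.

Lemma cauchy_law_fin_num (E : set R) : measurable E -> cauchy_law E \is a fin_num.
Proof.
move=> mE; rewrite ge0_fin_numE; last exact: (@measure_ge0 _ _ _ (@cauchy_law R)).
apply: (@le_lt_trans _ _ (cauchy_law [set: R])); last by rewrite cauchy_law_setT ltry.
by apply: (@le_measure _ _ _ (@cauchy_law R)); rewrite ?inE.
Qed.

End CotMixtureLaw.

(** * Atoms of a periodic point measure *)

Lemma set_mem_nil (T : eqType) : [set` [::] : seq T] = set0.
Proof. by apply/seteqP; split. Qed.

Lemma set_mem_cons (T : eqType) (y : T) (ys : seq T) :
  [set` y :: ys] = [set y] `|` [set` ys].
Proof.
apply/seteqP; split => z /=; rewrite inE; first by move=> /predU1P.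
by move=> zys; apply/predU1P.
Qed.

Lemma measurable_seq_set (R : realType) (ys : seq R) : measurable [set` ys].
Proof.
elim: ys => [|y ys ih]; first by rewrite set_mem_nil.
by rewrite set_mem_cons; exact: measurableU.
Qed.

Lemma integral_seq_set (R : realType) (m : {measure set R -> \bar R})
    (ys : seq R) (f : R -> R) :
  uniq ys -> measurable_fun setT f ->
  {in ys, forall y, m [set y] \is a fin_num} ->
  (\int[m]_(x in [set` ys]) (f x)%:E = (\sum_(y <- ys) fine (m [set y]) * f y)%:E)%E.
Proof.
move=> + mf; elim: ys => [_ _|y ys ih /= /andP[yys uys] fin].
  by rewrite set_mem_nil integral_set0 big_nil.
rewrite set_mem_cons integral_setU//.
- rewrite big_cons EFinD; congr (_ + _)%E; last first.
    by apply: ih => // z zys; apply: fin; rewrite inE zys orbT.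
  rewrite (eq_integral (cst (f y)%:E)); last by move=> x; rewrite inE/= => ->.
  by rewrite integral_cst// EFinM fineK ?fin ?mem_head// muleC.
- exact: measurable_seq_set.
- by apply: measurable_funTS; exact/measurable_EFinP.
- by apply/disj_setPS => x [/= ->]; rewrite (negbTE yys).
Qed.

Section PeriodicPointMeasure.
Context {R : realType}.
Variables (B : R) (m : {measure set R -> \bar R}).
Hypothesis B0 : 0 < B.
Hypothesis hm : periodic_point_measure B m.

Let X := msupp m.

Definition atom_weight (x : R) : R := fine (m [set x]).
Local Notation w := atom_weight.

Let weights_repr : exists v : R -> R, (forall x, X x -> 0 < v x) /\
  forall (E : set R) (ys : seq R), measurable E -> uniq ys ->
    X `&` E = [set` ys] -> m E = (\sum_(y <- ys) v y)%:E.
Proof.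
case: hm => -[_ [v [v0 vE]]] _ _; exists v; split => // E ys mE uys XE.
rewrite vE//.
have -> : (\esum_(x in X) ((v x)%:E * \d_x E) =
          \esum_(x in X) (if x \in E then (v x)%:E else 0))%E.
  by apply: eq_esum => x _; rewrite diracE; case: ifP; rewrite ?mule1 ?mule0.
rewrite -esum_mkcondr XE esum_fset.
- by rewrite -fsbig_seq// sumEFin.
- exact: finite_seq.
- by move=> x; rewrite inE -XE => -[Xx _]; rewrite lee_fin ltW// v0.
Qed.

Let setI_set1 x : X x -> X `&` [set x] = [set` [:: x]].
Proof.
move=> Xx; apply/seteqP; split => z /=; rewrite inE; first by move=> [_ ->].
by move=> /eqP ->.
Qed.

(** The weights of the representation of [m] are recovered as the masses of
    singletons, so that they no longer have to be carried along. *)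
Lemma point_measure_seq (E : set R) (ys : seq R) : measurable E -> uniq ys ->
  X `&` E = [set` ys] -> m E = (\sum_(y <- ys) w y)%:E.
Proof.
case: weights_repr => v [v0 vE] mE uys XE.
rewrite (vE _ ys)//; congr (_%:E); apply: eq_big_seq => y yys.
have [Xy _] : (X `&` E) y by rewrite XE.
by rewrite /w (vE _ [:: y])//= ?big_seq1//; exact: setI_set1.
Qed.

Lemma atom_weight_gt0 x : X x -> 0 < w x.
Proof.
case: weights_repr => v [v0 vE] Xx.
by rewrite /w (vE _ [:: x])//= ?big_seq1 ?v0//; exact: setI_set1.
Qed.

Lemma mass_set1_fin x : m [set x] \is a fin_num.
Proof.
have [Xx|nXx] := pselect (X x).
  by rewrite (@point_measure_seq _ [:: x])//; exact: setI_set1.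
rewrite (@point_measure_seq _ [::])//.
by apply/seteqP; split => z //= [+ zx]; rewrite zx.
Qed.

(** Being an atom is a condition on one mass only; periodicity of the support
    follows from it. *)
Lemma msuppP x : X x <-> 0 < w x.
Proof.
split; first exact: atom_weight_gt0.
move=> wx U oU Ux; apply: (@lt_le_trans _ _ (m [set x])).
  by rewrite -(fineK (mass_set1_fin x)) lte_fin.
apply: le_measure; rewrite ?inE//; first exact: open_measurable.
by move=> _ ->.
Qed.

Lemma atom_weightD x : w (x + B) = w x.
Proof.
case: hm => _ _ per; rewrite /w -[in RHS](per [set x])//.
by rewrite image_set1.
Qed.

Lemma atom_weightDz x (l : int) : w (x + l%:~R * B) = w x.
Proof.
have nat y k : w (y + k%:R * B) = w y.
  elim: k => [|k ih]; first by rewrite mul0r addr0.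
  by rewrite -natr1 mulrDl mul1r addrA atom_weightD ih.
case: l => k; first exact: nat.
by rewrite NegzE mulrNz mulNr -[LHS](nat _ k.+1) subrK.
Qed.

Lemma msuppDz x (l : int) : X (x + l%:~R * B) <-> X x.
Proof. by rewrite !msuppP atom_weightDz. Qed.

Lemma atoms_exist : {xs : seq R | uniq xs & X `&` `[0, B[ = [set` xs]}.
Proof.
apply/cid2; case: hm => -[lf _] _ _.
have : finite_set (X `&` `[0, B[).
  apply: sub_finite_set (lf 0 B) => x /= [Xx].
  by rewrite !in_itv/= => /andP[-> /ltW ->].
move=> /finite_seqP[s sE]; exists (undup s); first exact: undup_uniq.
by rewrite sE; apply/seteqP; split => x /=; rewrite mem_undup.
Qed.

Definition atoms : seq R := let: exist2 xs _ _ := atoms_exist in xs.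

Lemma atoms_uniq : uniq atoms.
Proof. by rewrite /atoms; case: atoms_exist. Qed.

Lemma atomsE : X `&` `[0, B[ = [set` atoms].
Proof. by rewrite /atoms; case: atoms_exist. Qed.

Lemma atomsP x : reflect (X x /\ 0 <= x < B) (x \in atoms).
Proof.
apply: (iffP idP) => [xa|[Xx xB]].
  have : (X `&` `[0, B[) x by rewrite atomsE.
  by rewrite /= in_itv/=.
by have : (X `&` `[0, B[) x; [split => //=; rewrite in_itv|rewrite atomsE].
Qed.

Lemma mod_period x : exists l : int, 0 <= x - l%:~R * B < B.
Proof.
exists (Num.floor (x / B)).
have := floor_itv (x / B); rewrite intrD ler_pdivlMr// ltr_pdivrMr//.
by rewrite mulrDl mul1r => /andP[? ?]; apply/andP; split; lra.
Qed.

Lemma atoms_neq_nil : atoms != [::].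
Proof.
apply/eqP => a0; case: hm => _ nz _; apply: nz => E mE.
rewrite (@point_measure_seq _ [::]) ?big_nil//.
apply/seteqP; split => x //= [Xx _].
have [l xl] := mod_period x.
have : x - l%:~R * B \in atoms by apply/atomsP; split => //; rewrite -mulNr -mulrNz;
  apply/msuppDz.
by rewrite a0.
Qed.

Definition total_weight : R := \sum_(x <- atoms) w x.

Lemma total_weight_gt0 : 0 < total_weight.
Proof.
have := atoms_neq_nil; rewrite /total_weight.
case: atoms (atomsP) => // x xs aP _.
rewrite big_cons ltr_pwDl//; first by apply/msuppP; have /aP[] := mem_head x xs.
by rewrite big_seq sumr_ge0// => y yxs; apply/ltW/msuppP;
  have /aP[] : y \in x :: xs by rewrite inE yxs orbT.
Qed.

Lemma cell_mass (E : set R) : measurable E -> E `<=` `[0, B[ ->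
  m E = (\sum_(x <- atoms) w x * (x \in E)%:R)%:E.
Proof.
move=> mE EB; rewrite (@point_measure_seq _ [seq x <- atoms | x \in E])//.
- rewrite big_filter; congr (_%:E).
  by rewrite big_mkcond; apply: eq_bigr => x _; case: ifP; rewrite ?mulr1 ?mulr0.
- by rewrite filter_uniq// atoms_uniq.
- apply/seteqP; split => x /=; rewrite mem_filter.
    by move=> [Xx Ex]; rewrite mem_set//=; apply/atomsP; split => //; have := EB _ Ex;
      rewrite /= in_itv.
  by move=> /andP[/set_mem Ex /atomsP[Xx _]].
Qed.

Lemma mean_densityE : mean_density B m = total_weight / B.
Proof.
rewrite /mean_density cell_mass//= mulrC; congr (_ / _).
apply: eq_big_seq => x /atomsP[_ xB]; rewrite mem_set ?mulr1//.
Qed.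

(** What is left of [D] after removing its atoms is a null set, and on
    finitely many atoms the integral splits into singletons. *)
Lemma point_measure_integral (D : set R) (ys : seq R) (f : R -> R) :
  measurable D -> uniq ys -> X `&` D = [set` ys] -> measurable_fun setT f ->
  (\int[m]_(x in D) (f x)%:E)%E = (\sum_(y <- ys) w y * f y)%:E.
Proof.
move=> mD uys XE mf.
have mys := measurable_seq_set ys.
have ysD : [set` ys] `<=` D by rewrite -XE; exact: subIsetr.
have mD' : measurable (D `\` [set` ys]) by exact: measurableD.
rewrite -(setDUK ysD) integral_setU//.
- rewrite integral_seq_set//; last by move=> y _; exact: mass_set1_fin.
  rewrite null_set_integral ?adde0//.
  + by apply: measurable_funTS; exact/measurable_EFinP.
  + rewrite (@point_measure_seq _ [::]) ?big_nil//.
    rewrite set_mem_nil; apply/seteqP; split => x //= [Xx [Dx]]; apply.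
    by have : (X `&` D) x by []; rewrite XE.
- by apply: measurable_funTS; exact/measurable_EFinP.
- by apply/disj_setPS => x [/= xs [_]].
Qed.

(** A window of whole periods contains each atom of the fundamental period
    together with exactly [2 N] of its translates. *)
Lemma block_integral (N : nat) (f : R -> R) : measurable_fun setT f ->
  (\int[m]_(x in `[(- (N%:R * B))%R, (N%:R * B)%R[) (f x)%:E)%E =
  (\sum_(x <- atoms) w x * \sum_(0 <= k < N.*2) f (x + (k%:R - N%:R) * B))%:E.
Proof.
move=> mf.
pose ys := [seq x + (k%:R - N%:R) * B | x <- atoms, k <- iota 0 N.*2].
have kNE k : k%:R - N%:R = (k%:Z - N%:Z)%:~R :> R by rewrite intrB.
have uys : uniq ys.
  apply: allpairs_uniq; rewrite ?atoms_uniq ?iota_uniq// => -[x k] [y l] /=.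
  move=> /allpairsP[[x' k'] /= [/atomsP[_ /andP[xa xb]] _ [-> ->]]].
  move=> /allpairsP[[y' l'] /= [/atomsP[_ /andP[ya yb]] _ [-> ->]]] e.
  have kl : k' = l'.
    have le (i j : nat) : i%:R * B < j%:R * B + B -> (i <= j)%N.
      by rewrite -[X in _ + X]mul1r -mulrDl ltr_pM2r// natr1 ltr_nat ltnS.
    by apply/eqP; rewrite eqn_leq !le//; lra.
  by move: e; rewrite kl => /addIr ->.
have XE : X `&` `[- (N%:R * B), N%:R * B[ = [set` ys].
  apply/seteqP; split => y /=.
    rewrite in_itv/= => -[Xy /andP[yl yr]].
    have [l /andP[l0 lB]] := mod_period y.
    have lN : l < N%:Z.
      by rewrite -(ltr_int R) -(ltr_pM2r B0); apply: le_lt_trans yr; rewrite -subr_ge0.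
    have Nl : - N%:Z <= l.
      rewrite -ltzD1 -(ltr_int R) -(ltr_pM2r B0) intrD mulrDl mul1r.
      by rewrite mulrNz mulNr (le_lt_trans yl)// addrC -ltrBlDr.
    apply/allpairsP; exists (y - l%:~R * B, absz (l + N%:Z)) => /=; split.
    - by apply/atomsP; rewrite l0 lB; split => //; rewrite -mulNr -mulrNz; exact/msuppDz.
    - by rewrite mem_iota; lia.
    - rewrite kNE gez0_abs; last by lia.
      by rewrite addrK subrK.
  move=> /allpairsP[[x k] /= [/atomsP[Xx /andP[x0 xB]]]].
  rewrite mem_iota add0n => /andP[_ kN] ->; split; first by rewrite kNE; apply/msuppDz.
  rewrite in_itv/=; apply/andP; split.
    by rewrite mulrBl -[leLHS]add0r addrA lerD2r addr_ge0// mulr_ge0// ltW.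
  apply: (@lt_le_trans _ _ (B + (k%:R - N%:R) * B)); first by rewrite ltrD2r.
  have : k.+1%:R * B <= N.*2%:R * B by rewrite ler_pM2r// ler_nat.
  by rewrite -natr1 -addnn natrD; lra.
rewrite (point_measure_integral _ uys XE)//; congr (_%:E).
rewrite /ys big_allpairs_dep; apply: eq_bigr => x _.
rewrite mulr_sumr /index_iota subn0; apply: eq_bigr => k _.
by rewrite kNE atom_weightDz.
Qed.

End PeriodicPointMeasure.

(** * The principal value *)

Lemma cvg_sum_in (R : realType) (T : Type) (F : set_system T) (FF : Filter F)
    (I : eqType) (r : seq I) (f : I -> T -> R) (l : I -> R) :
  {in r, forall i, f i x @[x --> F] --> l i} ->
  \sum_(i <- r) f i x @[x --> F] --> \sum_(i <- r) l i.
Proof.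
move=> fl; rewrite [X in _ --> X]big_seq; under eq_fun do rewrite big_seq.
by apply: cvg_big => [|i ir]; [exact: add_continuous|exact: fl].
Qed.

Section LatticeSum.
Context {R : realType}.
Variable B : R.
Hypothesis B0 : 0 < B.

Lemma lattice_sumE (n : nat) (t : R) :
  \sum_(0 <= k < n.*2) (t - (k%:R - n%:R) * B)^-1 =
  pi / B * - pole_sum n (pi / B * - t).
Proof.
have pin0 : pi != 0 :> R by rewrite gt_eqF// pi_gt0.
have Bn0 : B != 0 by rewrite gt_eqF.
have scale u : u^-1 = pi / B * - (pi / B * - u)^-1.
  by rewrite [_ * - u]mulrN invrN opprK invfM mulrA divff ?mul1r// mulf_neq0// invr_eq0.
rewrite sum_fold big_nat_rev /pole_sum -sumrN mulr_sumr !big_nat.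
apply: eq_bigr => k /andP[_ kn]; rewrite add0n opprD mulrDr.
rewrite [X in X + _]scale [X in _ + X]scale [RHS]addrC.
have k1 : (n - k.+1)%:R = n%:R - k.+1%:R :> R by rewrite natrB.
congr (_ * - _^-1 + _ * - _^-1); rewrite ?k1.
  by field.
have -> : (n.*2 - (n - k.+1).+1 = n + k)%N by rewrite -addnn; lia.
by rewrite natrD; field.
Qed.

Lemma cvg_lattice_sum (t : R) :
  \sum_(0 <= k < n.*2) (t - (k%:R - n%:R) * B)^-1 @[n --> \oo] -->
  pi / B * cot (pi / B * t).
Proof.
under eq_fun do rewrite lattice_sumE.
apply: cvgM; first exact: cvg_cst.
have -> : cot (pi / B * t) = - cot (pi / B * - t) by rewrite mulrN cotN opprK.
by apply: cvgN; exact: cvg_pole_sum.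
Qed.

Lemma cvg_trunc : Num.trunc (A / B) @[A --> +oo] --> \oo.
Proof.
apply/cvgnyPge => M; near=> A.
have A0 : 0 <= A / B by rewrite divr_ge0 ?(ltW B0)//; near: A; exact: nbhs_pinfty_ge.
have /andP[_ h] := truncn_itv A0.
rewrite -ltnS -(ltr_nat R); apply: le_lt_trans h.
rewrite ler_pdivlMr//; near: A; exact: nbhs_pinfty_ge.
Unshelve. all: end_near. Qed.

End LatticeSum.

Section PrincipalValue.
Context {R : realType}.
Variables (B : R) (m : {measure set R -> \bar R}).
Hypothesis B0 : 0 < B.
Hypothesis hm : periodic_point_measure B m.
Local Notation w := (atom_weight m).
Local Notation atoms := (atoms hm).

Let Nt (A : R) : nat := Num.trunc (A / B).

Let cut (s A x : R) : R := (s - x)^-1 * \1_(`[- A, A]) x.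

(** With [N] the integer part of [A / B], the window [`[- A, A]] contains the
    whole periods between [- N B] and [N B] and is contained in those between
    [- (N + 1) B] and [(N + 1) B].  Only the two extreme translates of each atom
    depend on [A] more finely than through [N]. *)
Lemma truncated_integralE (s A : R) : 0 <= A ->
  truncated_integral m s A =
  (\sum_(x <- atoms) w x *
     (\sum_(0 <= k < (Nt A).*2) (s - x - (k%:R - (Nt A)%:R) * B)^-1 +
      (cut s A (x + (Nt A)%:R * B) + cut s A (x - (Nt A).+1%:R * B))))%:E.
Proof.
move=> A0; set N := Nt A.
have /andP[NA AN] : N%:R * B <= A < N.+1%:R * B.
  by rewrite -ler_pdivlMr// -ltr_pdivrMr//; apply: truncn_itv; rewrite divr_ge0// ltW.
have mcut : measurable_fun setT (cut s A).
  apply: measurable_funM; last exact: measurable_indic.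
  apply: (@measurableT_comp _ _ _ R R R (@GRing.inv R)); first exact: measurable_invr.
  exact: measurable_funB.
transitivity (\int[m]_(x in `[(- (N.+1%:R * B))%R, (N.+1%:R * B)%R[) (cut s A x)%:E)%E.
  rewrite /truncated_integral.
  have -> : `[- A, A]%classic = `[- (N.+1%:R * B), N.+1%:R * B[ `&` `[- A, A].
    apply/seteqP; split => x /=; rewrite !in_itv/=; last by case.
    by move=> /andP[h1 h2]; split; apply/andP; split => //; lra.
  rewrite integral_mkcondr; apply: eq_integral => x _.
  by rewrite patchE /cut indicE; case: ifP => _; rewrite ?mulr1 ?mulr0.
rewrite (block_integral B0 hm)//; congr (_%:E);
  apply: eq_big_seq => x /atomsP[_ /andP[x0 xB]].
congr (_ * _); rewrite doubleS big_nat_recr// big_nat_recl//= -addrA addrC -addrA.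
have NB0 : 0 <= N%:R * B by rewrite mulr_ge0// ltW.
congr (_ + _); last first.
  congr (cut _ _ _ + cut _ _ _); last by ring.
  by rewrite -addnn -!natr1 natrD; ring.
rewrite !big_nat; apply: eq_bigr => k /andP[_ kN].
rewrite /cut indicE mem_set ?mulr1.
  by congr (_^-1); rewrite -!natr1; ring.
have kB : 0 <= k%:R * B by rewrite mulr_ge0// ltW.
have kNB : k.+1%:R * B <= N.*2%:R * B by rewrite ler_pM2r// ler_nat.
rewrite /= in_itv/= -!natr1; move: kNB; rewrite -natr1 -addnn natrD => kNB.
by apply/andP; split; lra.
Qed.

Lemma cut_bound (s A x : R) (c : R) : 0 < c -> c <= `|s - x| -> `|cut s A x| <= c^-1.
Proof.
move=> c0 cs; rewrite /cut normrM indicE.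
apply: (@le_trans _ _ (`|(s - x)^-1| * 1)).
  by rewrite ler_wpM2l//; case: (_ \in _); rewrite ?normr1 ?normr0.
by rewrite mulr1 normfV lef_pV2// posrE (lt_le_trans c0).
Qed.

Definition pv_limit (s : R) : R :=
  \sum_(x <- atoms) w x * (pi / B * cot (pi / B * (s - x))).

(** The two extreme translates are at distance at least [N B - |s|] from [s],
    and the terms of the other ones form a partial sum of the expansion of
    the cotangent. *)
Lemma cvg_truncated_integral (s : R) :
  truncated_integral m s A @[A --> +oo] --> (pv_limit s)%:E.
Proof.
pose F A := \sum_(x <- atoms) w x *
     (\sum_(0 <= k < (Nt A).*2) (s - x - (k%:R - (Nt A)%:R) * B)^-1 +
      (cut s A (x + (Nt A)%:R * B) + cut s A (x - (Nt A).+1%:R * B))).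
suff FP : F A @[A --> +oo] --> pv_limit s.
  have : (F A)%:E @[A --> +oo] --> (pv_limit s)%:E by apply: cvg_EFin => //; near=> A.
  apply: cvg_trans; apply: near_eq_cvg; near=> A.
  by rewrite truncated_integralE//; near: A; exact: nbhs_pinfty_ge.
apply: cvg_sum_in => x xa.
apply: cvgM; first exact: cvg_cst.
rewrite -[X in _ --> X]addr0; apply: cvgD.
  apply: (@cvg_comp _ _ _ Nt
    (fun n => \sum_(0 <= k < n.*2) (s - x - (k%:R - n%:R) * B)^-1) _ \oo).
    exact: cvg_trunc.
  exact: cvg_lattice_sum.
have b0 : (- `|s| + (Nt A)%:R * B)^-1 @[A --> +oo] --> (0 : R).
  have Bn0 : B != 0 by rewrite gt_eqF.
  exact: (@cvg_comp _ _ _ Nt (fun n => (- `|s| + n%:R * B)^-1)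
    _ _ _ (cvg_trunc B0) (cvg_inv_affine (- `|s|) Bn0)).
have bN0 : - (- `|s| + (Nt A)%:R * B)^-1 @[A --> +oo] --> (0 : R).
  by rewrite -[X in _ --> X]oppr0; apply: cvgN.
have bpos : \forall A \near +oo, 0 < - `|s| + (Nt A)%:R * B.
  near=> A; have A0 : 0 <= A by near: A; exact: nbhs_pinfty_ge.
  have sA : `|s| + B <= A by near: A; exact/nbhs_pinfty_ge/num_real.
  have /andP[_] : (Nt A)%:R <= A / B < (Nt A).+1%:R.
    by apply: truncn_itv; rewrite divr_ge0// ltW.
  by rewrite ltr_pdivrMr// -natr1; lra.
have /atomsP[_ /andP[x0 xB]] := xa.
have sq (g : R -> R) : (\forall A \near +oo, `|g A| <= (- `|s| + (Nt A)%:R * B)^-1) ->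
    g A @[A --> +oo] --> (0 : R).
  move=> gb; apply: squeeze_cvgr bN0 b0.
  by near=> A; rewrite -ler_norml; near: A.
rewrite -[X in _ --> X]addr0; apply: cvgD; apply: sq; near=> A.
- apply: cut_bound; first by near: A.
  rewrite distrC; apply: le_trans (ler_norm _).
  by have := ler_norm s; lra.
- apply: cut_bound; first by near: A.
  have h1 := ler_norm (- s); rewrite normrN in h1.
  by apply: le_trans (ler_norm _); rewrite -natr1; lra.
Unshelve. all: end_near. Qed.

Lemma pv_transformE (s : R) : pv_transform m s = pv_limit s.
Proof.
rewrite /pv_transform (@cvg_lim _ (@ereal_hausdorff R) _ _ _ _ _
  (cvg_truncated_integral (s := s))).
by [].
Qed.

Lemma pv_transform_normalized (s : R) :
  pv_transform m s / (pi * mean_density B m) =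
  atom_mixture B atoms (fun x => w x / total_weight hm) s.
Proof.
rewrite pv_transformE (mean_densityE hm) /pv_limit /atom_mixture mulr_suml.
apply: eq_bigr => x _.
have W0 := total_weight_gt0 B0 hm.
have pin0 : pi != 0 :> R by rewrite gt_eqF// pi_gt0.
have Bn0 : B != 0 by rewrite gt_eqF.
have Wn0 : total_weight hm != 0 by rewrite gt_eqF.
move: (cot _) => z; move: pi pin0 => q q0.
by field; rewrite Wn0 Bn0 q0.
Qed.

Lemma pv_transform_periodic (s : R) : pv_transform m (s + B) = pv_transform m s.
Proof.
rewrite !pv_transformE; apply: eq_bigr => x _.
by rewrite cot_scaledD// gt_eqF.
Qed.

Lemma normalized_law (a : R) (E : set R) : measurable E ->
  lebesgue_measure ((fun s => pv_transform m s / (pi * mean_density B m)) @^-1` E `&`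
    `[a, a + B[) =
  (B%:E * cauchy_law E)%E.
Proof.
move=> mE; have W0 := total_weight_gt0 B0 hm.
rewrite (_ : (fun s => _) = atom_mixture B atoms (fun x => w x / total_weight hm));
  last first.
  by apply/funext => s; exact: pv_transform_normalized.
apply: atom_mixture_law => //.
- exact: atoms_uniq.
- by move=> x /atomsP[].
- by move=> x /atomsP[Xx _]; rewrite divr_gt0//; exact/(msuppP hm).
- by rewrite -mulr_suml divff// gt_eqF.
Qed.

End PrincipalValue.

(** * Discretisation of sums over the atoms *)

Section Discretisation.
Context {R : realType}.

Lemma sin_eq0_shift (u : R) (l : int) : (sin (u + l%:~R * pi) == 0) = (sin u == 0).
Proof.
have nat (v : R) (k : nat) : (sin (v + k%:R * pi) == 0) = (sin v == 0).
  by rewrite mulr_natl (alternatingn (@sinDpi R)) mulf_eq0 signr_eq0.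
case: l => k; first exact: nat.
by rewrite NegzE mulrNz mulNr -[LHS](nat _ k.+1) subrK.
Qed.

Lemma sin_period_eq0 (B t : R) : 0 < B -> sin (pi / B * t) = 0 ->
  exists l : int, t = l%:~R * B.
Proof.
move=> B0 st; have [l /andP[r0 rB]] := mod_period B0 t; exists l.
have Bn0 : B != 0 by rewrite gt_eqF.
apply/eqP; rewrite -subr_eq0 eq_le r0 andbT leNgt; apply/negP => r1.
have : sin (pi / B * (t - l%:~R * B)) != 0.
  have c0 : 0 < pi / B by rewrite divr_gt0// pi_gt0.
  rewrite gt_eqF// sin_gt0_pi// mulr_gt0//=.
  by rewrite mulrAC ltr_pdivrMr// ltr_pM2l// pi_gt0.
have -> : pi / B * (t - l%:~R * B) = pi / B * t + (- l)%:~R * pi.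
  by rewrite mulrNz; field.
by rewrite sin_eq0_shift st eqxx.
Qed.

Variable B : R.
Hypothesis B0 : 0 < B.

Definition step (k : nat) : R := B / k.+1%:R.

Lemma step_gt0 k : 0 < step k. Proof. by rewrite divr_gt0. Qed.

Definition grid (k : nat) (x : R) : R := (Num.floor (x / step k))%:~R * step k.

Lemma grid_itv k x : grid k x <= x < grid k x + step k.
Proof.
have := floor_itv (x / step k); rewrite intrD ler_pdivlMr ?step_gt0//.
by rewrite ltr_pdivrMr ?step_gt0// mulrDl mul1r.
Qed.

Lemma gridD k x (l : int) : grid k (x + l%:~R * B) = grid k x + l%:~R * B.
Proof.
have sB : k.+1%:R * step k = B by rewrite mulrC divfK.
rewrite /grid; have -> : (x + l%:~R * B) / step k = x / step k + (l * k.+1)%:~R.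
  by rewrite intrM mulrDl -[X in _ + _ * X / _]sB mulrA mulfK// gt_eqF ?step_gt0.
by rewrite floorDrz// intrKfloor intrD mulrDl intrM -mulrA sB.
Qed.

Lemma cvg_grid x : grid k x @[k --> \oo] --> x.
Proof.
have s0 : step k @[k --> \oo] --> (0 : R).
  rewrite -[X in _ --> X](mulr0 B); apply: cvgM; first exact: cvg_cst.
  exact: cvg_harmonic.
apply: (@squeeze_cvgr _ _ _ _ (fun k => x - step k) (fun=> x)).
- by near=> k; have /andP[h1 h2] := grid_itv k x; rewrite h1 andbT lerBlDr ltW.
- rewrite -[X in _ --> X]subr0; apply: cvgB; [exact: cvg_cst|exact: s0].
- exact: cvg_cst.
Unshelve. all: end_near. Qed.

Lemma measurable_grid k : measurable_fun [set: R] (grid k).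
Proof.
apply: measurable_funM => //.
apply: nondecreasing_measurable => // x y xy.
by rewrite ler_int le_floor// ler_pM2r// invr_gt0 step_gt0.
Qed.

Definition cell (k j : nat) : set R := `[j%:R * step k, j.+1%:R * step k[%classic.

Lemma sum_cell (F : R -> R) k x : 0 <= x < B ->
  \sum_(0 <= j < k.+1) F (j%:R * step k) * (x \in cell k j)%:R = F (grid k x).
Proof.
move=> /andP[x0 xB]; have xs0 : 0 <= x / step k by rewrite divr_ge0// ltW// step_gt0.
pose j0 := Num.trunc (x / step k).
have cellE j : (x \in cell k j) = (j0 == j).
  rewrite /j0 truncn_eq// ler_pdivlMr ?step_gt0// ltr_pdivrMr ?step_gt0//.
  by apply/idP/idP; rewrite inE /cell/= in_itv.
have j0k : (j0 < k.+1)%N.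
  rewrite -(ltr_nat R); have /andP[h _] := truncn_itv xs0.
  apply: (le_lt_trans h); rewrite ltr_pdivrMr ?step_gt0//.
  by rewrite mulrC divfK.
rewrite big_mkord (bigD1 (Ordinal j0k))//= big1 ?addr0.
  rewrite cellE eqxx mulr1; congr F; rewrite /grid; congr (_ * _).
  by rewrite /j0 truncn_floor xs0 natr_absz ger0_norm// floor_ge0.
move=> j jj0; rewrite cellE; case: eqVneq => [e|_]; last by rewrite mulr0.
by move: jj0; rewrite -val_eqE/= e eqxx.
Qed.

Lemma cell_sub k j : (j < k.+1)%N -> cell k j `<=` `[0, B[.
Proof.
move=> jk x; rewrite /cell /= !in_itv/= => /andP[h1 h2]; apply/andP; split.
  by rewrite (le_trans _ h1)// mulr_ge0// ltW// step_gt0.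
apply: (lt_le_trans h2); rewrite -[leRHS](divfK (_ : k.+1%:R != 0))//.
by rewrite -/(step k) mulrC ler_pM2l ?step_gt0// ler_nat.
Qed.

Definition grid_sum (f : R -> R) (m : set R -> \bar R) (k : nat) (s : R) : R :=
  \sum_(0 <= j < k.+1) f (grid k s - j%:R * step k) * fine (m (cell k j)).

(** The sum replaces every atom by the left end of its cell, and [s] by the left
    end of its own.  An atom in the same class modulo [B] as [s] is displaced
    exactly as [s] is, so [f] need not be continuous at multiples of [B]. *)
Lemma cvg_grid_sum (f : R -> R) (m : {measure set R -> \bar R})
    (hm : periodic_point_measure B m) (s : R) :
  (forall t, sin (pi / B * t) != 0 -> {for t, continuous f}) ->
  grid_sum f m k s @[k --> \oo] -->
  \sum_(x <- atoms hm) atom_weight m x * f (s - x).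
Proof.
move=> fc.
have -> : grid_sum f m ^~ s = fun k =>
    \sum_(x <- atoms hm) atom_weight m x * f (grid k s - grid k x).
  apply/funext => k; rewrite /grid_sum.
  under eq_big_nat => j /andP[_ jk].
    rewrite (cell_mass hm)/=; [|exact: measurable_itv|exact: cell_sub].
    rewrite mulr_sumr.
  over.
  rewrite exchange_big/=; apply: eq_big_seq => x /atomsP[_ xB].
  under eq_bigr do rewrite mulrCA.
  by rewrite -mulr_sumr (sum_cell (fun y => f (grid k s - y))).
apply: cvg_sum_in => x _; apply: cvgM; first exact: cvg_cst.
have [/eqP/(sin_period_eq0 B0)[l lE]|sn0] := boolP (sin (pi / B * (s - x)) == 0).
  have -> : (fun k => f (grid k s - grid k x)) = fun=> f (s - x).
    apply/funext => k; congr f.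
    have -> : s = x + l%:~R * B by rewrite -lE; ring.
    by rewrite gridD; ring.
  exact: cvg_cst.
apply: (@cvg_comp _ _ _ (fun k => grid k s - grid k x) f _ (nbhs (s - x))).
  by apply: cvgB; exact: cvg_grid.
exact: fc.
Qed.

End Discretisation.

(** * Measurability in the measure and the point *)

Section RandomMeasure.
Context {R : realType} d (T : measurableType d).
Variables (B : R) (M : T -> {measure set R -> \bar R}).
Hypothesis B0 : 0 < B.
Hypothesis mM : forall E, measurable E -> measurable_fun setT (fun w => M w E).
Hypothesis hM : forall w, periodic_point_measure B (M w).

(** The enumeration of the atoms is not chosen measurably; the sum is
    measurable as a limit of sums that only involve masses of fixed sets. *)
Lemma measurable_atom_sum (f : R -> R) : measurable_fun setT f ->
  (forall t, sin (pi / B * t) != 0 -> {for t, continuous f}) ->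
  measurable_fun setT (fun ws : T * R =>
    \sum_(x <- atoms (hM ws.1)) atom_weight (M ws.1) x * f (ws.2 - x)).
Proof.
move=> mf fc.
apply: (@measurable_fun_cvg _ _ R setT
  (fun k (ws : T * R) => grid_sum B f (M ws.1) k ws.2)) => [k|ws _]; last first.
  exact: cvg_grid_sum.
apply: measurable_sum => j; apply: measurable_funM.
  apply: (@measurableT_comp _ _ _ _ R R f _ (fun ws : T * R =>
    grid B k ws.2 - j%:R * step B k)) => //.
  apply: measurable_funB => //.
  apply: (@measurableT_comp _ _ _ _ R R (grid B k)); first exact: measurable_grid.
  exact: measurable_snd.
apply: (@measurableT_comp _ _ _ _ (\bar R) R fine _ (fun ws : T * R =>
  M ws.1 (cell B k j))).
  exact: fine_measurable.
apply: (@measurableT_comp _ _ _ _ T _ (fun w => M w (cell B k j)) _ fst).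
  by apply: mM; exact: measurable_itv.
exact: measurable_fst.
Qed.

Lemma measurable_pv_normalized : measurable_fun setT (fun ws : T * R =>
  pv_transform (M ws.1) ws.2 / (pi * mean_density B (M ws.1))).
Proof.
apply: measurable_funM.
  have -> : (fun ws : T * R => pv_transform (M ws.1) ws.2) = (fun ws : T * R =>
      \sum_(x <- atoms (hM ws.1)) atom_weight (M ws.1) x *
        (pi / B * cot (pi / B * (ws.2 - x)))).
    by apply/funext => ws; rewrite (pv_transformE B0 (hM ws.1)).
  apply: (@measurable_atom_sum (fun t => pi / B * cot (pi / B * t))).
    apply: measurable_funM => //.
    apply: (@measurableT_comp _ _ _ R R R (@cot R) _ (fun t => pi / B * t)).
      exact: measurable_cot.
    exact: measurable_funM.
  move=> t st; apply: cvgM; first exact: cvg_cst.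
  apply: (@continuous_comp _ _ _ (fun t => pi / B * t) (@cot R));
    last exact: continuous_cot.
  by apply: cvgM; [exact: cvg_cst|exact: cvg_id].
apply: (@measurableT_comp _ _ _ _ R R (@GRing.inv R)); first exact: measurable_invr.
apply: measurable_funM => //; apply: measurable_funM => //.
apply: (@measurableT_comp _ _ _ _ (\bar R) R fine _ (fun ws : T * R =>
  M ws.1 `[0, B[%classic)).
  exact: fine_measurable.
apply: (@measurableT_comp _ _ _ _ T _ (fun w => M w `[0, B[%classic) _ fst).
  by apply: mM; exact: measurable_itv.
exact: measurable_fst.
Qed.

(** The total mass of the atoms congruent to [s] is a sum over the atoms to
    which [measurable_atom_sum] applies, with [f] the indicator of the multiples
    of [B]; it is positive exactly on the support. *)
Lemma measurable_msupp : measurable [set ws : T * R | msupp (M ws.1) ws.2].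
Proof.
pose f (t : R) : R := if sin (pi / B * t) == 0 then 1 else 0.
pose F (ws : T * R) := \sum_(x <- atoms (hM ws.1)) atom_weight (M ws.1) x * f (ws.2 - x).
have mF : measurable_fun setT F.
  apply: measurable_atom_sum.
    apply: measurable_fun_if => //.
    apply: measurable_fun_eqr => //.
    apply: (@measurableT_comp _ _ _ R R R (@sin R) _ (fun t => pi / B * t)).
      by apply: continuous_measurable_fun; exact: continuous_sin.
    exact: measurable_funM.
  move=> t st.
  have cs : {for t, continuous (fun t => sin (pi / B * t))}.
    apply: (@continuous_comp _ _ _ (fun t => pi / B * t) (@sin R));
      last exact: continuous_sin.
    by apply: cvgM; [exact: cvg_cst|exact: cvg_id].
  have nz : \forall u \near t, sin (pi / B * u) != 0.
    exact: (cvgr_neq0 _ cs st).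
  have ft : f t = 0 by rewrite /f (negbTE st).
  suff : f u @[u --> t] --> f t by [].
  rewrite ft; apply: cvg_near_cst; near=> u.
  have : sin (pi / B * u) != 0 by near: u.
  by rewrite /f => /negbTE ->.
rewrite (_ : [set _ | _] = F @^-1` `]0, +oo[).
  by rewrite -[X in measurable X]setTI; apply: mF => //; exact: measurable_itv.
apply/seteqP; split => -[w s] /=; rewrite in_itv/= andbT.
- move=> ws.
  have [l sl] := mod_period B0 s.
  have xa : s - l%:~R * B \in atoms (hM w).
    apply/atomsP; split => //.
    by rewrite -mulNr -mulrNz; apply/(msuppDz (hM w)).
  rewrite /F (big_rem _ xa)/= ltr_pwDl//; last first.
    apply: sumr_ge0 => x _; rewrite mulr_ge0//; first exact: fine_ge0.
    by rewrite /f; case: ifP.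
  rewrite /f (_ : pi / B * _ = 0 + l%:~R * pi); last first.
    by rewrite subKr add0r mulrCA divfK// gt_eqF.
  rewrite sin_eq0_shift sin0 eqxx mulr1.
  by apply/(msuppP (hM w)); have /atomsP[] := xa.
- move=> /lt0r_neq0; rewrite /F/= => Fn0.
  have [x xa fx] : exists2 x, x \in atoms (hM w) & sin (pi / B * (s - x)) = 0.
    apply: contrapT => /forall2NP h; move/eqP: Fn0; apply.
    rewrite big_seq big1// => x xa; have [//|] := h x.
    by move=> /eqP/negbTE fx; rewrite /f fx mulr0.
  have [l lE] := sin_period_eq0 B0 fx.
  have -> : s = x + l%:~R * B by rewrite -lE addrC subrK.
  by apply/(msuppDz (hM w)); have /atomsP[] := xa.
Unshelve. all: end_near. Qed.

End RandomMeasure.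

(** * The uniform law on a period *)

Section UniformPeriod.
Context {R : realType}.
Local Notation mu := (@lebesgue_measure R).
Variables (a B : R).
Hypothesis ab : a < a + B.

Lemma uniform_prob_period (Q : set R) : measurable Q ->
  uniform_prob ab Q = (B^-1%:E * mu (Q `&` `[a, (a + B)%R[))%E.
Proof.
move=> mQ; rewrite /uniform_prob integral_uniform_pdf.
rewrite (eq_integral (cst (B^-1)%:E)); last first.
  by move=> x; rewrite inE/= in_itv/= => -[_ h]; rewrite /uniform_pdf h addrC addKr.
rewrite integral_cst; last exact: measurableI.
congr (_ * _)%E.
have -> : Q `&` `[a, a + B] = (Q `&` `[a, a + B[) `|` (Q `&` [set a + B]).
  rewrite -setIUr; congr (_ `&` _); apply/seteqP; split => x /=; rewrite !in_itv/=.
    by move=> /andP[-> /=]; rewrite le_eqVlt => /predU1P[->|->]; [right|left].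
  by move=> [/andP[-> /ltW ->]|->]; rewrite ?lexx ?ltW.
rewrite measureU; last 3 first.
- exact: measurableI.
- exact: measurableI.
- apply/seteqP; split => // x /= [[_ xi] [_ xe]].
  by move: xi; rewrite xe in_itv/= ltxx andbF.
rewrite [X in (_ + X)%E](_ : _ = 0%E) ?adde0//.
apply: countable_lebesgue_measure0; apply: finite_set_countable.
exact: finite_setIr.
Qed.

Lemma uniform_prob_locally_finite (X : set R) : measurable X ->
  locally_finite_set X -> uniform_prob ab X = 0%E.
Proof.
move=> mX lX; rewrite uniform_prob_period// countable_lebesgue_measure0 ?mule0//.
apply: finite_set_countable; apply: sub_finite_set (lX a (a + B)).
by move=> x [Xx]; rewrite /= !in_itv/= => /andP[-> /ltW ->].
Qed.

End UniformPeriod.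

(** * Conditioning on the random measure *)

Theorem theorem2p2 (R : realType) (B : R) (B_gt0 : 0 < B) :
  (forall m : {measure set R -> \bar R}, periodic_point_measure B m ->
     [/\ forall s, ~ msupp m s ->
           truncated_integral m s A @[A --> +oo] --> (pv_transform m s)%:E,
         forall s, msupp m (s + B) <-> msupp m s &
         forall s, ~ msupp m s -> pv_transform m (s + B) = pv_transform m s])
  /\
  (forall (d : measure_display) (Omega : measurableType d)
          (P : probability Omega R)
          (M : R.-ker Omega ~> R) (S : {RV P >-> R})
          (a : R) (a_lt : a < a + B),
     (forall w, periodic_point_measure B (M w)) ->
     (forall E, measurable E -> distribution P S E = uniform_prob a_lt E) ->
     independent_sigma P (sigma_random_measure M) (sigma_random_variable S) ->
     {ae P, forall w, ~ msupp (M w) (S w)} /\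
     conditional_law P (sigma_random_measure M)
       (fun w => pv_transform (M w) (S w) / (pi * mean_density B (M w)))
       cauchy_law).
Proof.
split=> [m hm|d Omega P M S a a_lt hM unifS indep].
  split=> [s _|s|s _].
  - by rewrite (pv_transformE B_gt0 hm); exact: cvg_truncated_integral.
  - by have := msuppDz hm s 1; rewrite mul1r.
  - exact: (pv_transform_periodic B_gt0 hm).
(* [T] is [Omega] with the sigma-algebra generated by [M], so that measurability
   on the product [T * R] is measurability in the pair [(M, S)]. *)
pose gen : set (set Omega) := \bigcup_(E in (@measurable _ R))
  preimage_set_system setT (fun w => M w E) measurable.
pose T : measurableType gen.-sigma := g_sigma_algebraType gen.
have genO (C : set T) : measurable C -> measurable (C : set Omega).
  move=> mC; apply: (smallest_sub _ _ mC); first exact: sigma_algebra_measurable.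
  by move=> _ [E mE [D mD <-]]; exact: measurable_kernel.
pose MT (w : T) : {measure set R -> \bar R} := M w.
have mMT E : measurable E -> measurable_fun setT (fun w : T => MT w E).
  move=> mE _ D mD; apply: sub_sigma_algebra; exists E => //.
  by exists D.
have hMT w : periodic_point_measure B (MT w) by exact: hM.
have mid : measurable_fun setT (id : Omega -> T).
  by move=> _ C mC; rewrite setTI; exact: genO.
pose idT : {RV P >-> T} := mfun_Sub (mem_set mid).
have mpair : measurable_fun setT (fun w => (idT w, S w)).
  by apply: measurable_fun_pair => //; exact: measurable_funPT.
pose pairT : {RV P >-> (T * R)%type} := mfun_Sub (mem_set mpair).
(* Independence says that the law of [(M, S)] agrees with the product of the
   marginals on rectangles, hence everywhere. *)
have joint (H : set (T * R)) : measurable H ->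
    P [set w | H (w : T, S w)] =
    (\int[distribution P idT]_w distribution P S (xsection H w))%E.
  move=> mH.
  apply/esym/(@product_measure_unique _ _ T R R (distribution P idT)
    (distribution P S) (distribution P pairT)) => // A D mA mD.
  transitivity (P ((A : set Omega) `&` S @^-1` D)); first by [].
  apply: (indep (A : set Omega) (S @^-1` D)); first exact: mA.
  by exists D => //; rewrite setTI.
have mnorm := measurable_pv_normalized B_gt0 mMT hMT.
split.
  have mX := measurable_msupp B_gt0 mMT hMT.
  exists [set w | msupp (M w) (S w)]; split.
  - by rewrite -[X in measurable X]setTI; exact: (mpair measurableT _ mX).
  - have := joint _ mX; rewrite /= => ->.
    apply: integral0_eq => w _.
    have mXw : measurable (xsection [set ws : T * R | msupp (MT ws.1) ws.2] w).
      exact: measurable_xsection.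
    rewrite unifS//; apply: uniform_prob_locally_finite => //.
    have [[lf _] _ _] := hM w.
    move=> u v; apply: sub_finite_set (lf u v) => x [/xsectionP /= ? ?].
    by split.
  - by move=> w /= /contrapT.
split.
  have mc := measurableT_comp mnorm mpair.
  exact: mc.
move=> E mE; split.
- move=> C [D mD <-]; rewrite setTI preimage_cst; case: ifP => _.
    exact: (@measurableT _ T).
  exact: (@measurable0 _ T).
- rewrite -(fineK (cauchy_law_fin_num mE)); exact: finite_measure_integrable_cst.
- move=> C mC.
  have mCT : measurable (C : set T) := mC.
  pose Phi (ws : T * R) := pv_transform (MT ws.1) ws.2 / (pi * mean_density B (MT ws.1)).
  pose H : set (T * R) := Phi @^-1` E `&` (fst @^-1` C).
  have mH : measurable H.
    apply: measurableI; first by rewrite -[X in measurable X]setTI;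
      exact: (mnorm measurableT _ mE).
    by rewrite -[X in measurable X]setTI;
      exact: (@measurable_fst _ _ T R measurableT _ mCT).
  have := joint H mH; rewrite /= => ->.
  rewrite integral_cst; last exact: genO.
  (* The section of [H] at [w] is empty unless [w] lies in [C], and then its
     mass does not depend on [w]. *)
  have sec w : distribution P S (xsection H w) = (cst (cauchy_law E) \_ (C : set T)) w.
    have mHw : measurable (xsection H w) by exact: measurable_xsection.
    rewrite patchE; case: ifPn => [/set_mem Cw|/negP nCw].
      rewrite unifS// uniform_prob_period//.
      have -> : xsection H w = (fun s => Phi (w, s)) @^-1` E.
        by apply/seteqP; split => s; [move=> /xsectionP[]|move=> Es; apply/xsectionP;
          split].
      rewrite (normalized_law B_gt0 (hMT w))//.
      by rewrite muleA -EFinM mulVf ?mul1e// gt_eqF.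
    rewrite (_ : xsection H w = set0) ?measure0//.
    by apply/seteqP; split => s // /xsectionP[_ /= Cw]; apply: nCw; exact: mem_set.
  rewrite (eq_integral (cst (cauchy_law E) \_ (C : set T))); last by move=> w _; exact: sec.
  by rewrite -integral_mkcond integral_cst.
Qed.
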